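(* Let $M$ be a compact connected manifold with (nonempty) boundary $\partial M$ which is not homeomorphic to a closed interval. Then for every positive integer $n$, the set $$\Omega_n=\{(g_1,\dots,g_n)\in \mathrm{Homeo}_0(M,\partial M)^n : \langle g_1,\dots,g_n\rangle \text{ is dense in } \mathrm{Homeo}_0(M,\partial M)\}$$ is contained in a closed nowhere dense subset of $\mathrm{Homeo}_0(M,\partial M)^n$.
   Context: $\mathrm{Homeo}_0(M,\partial M)$ denotes the connected component of the identity in the group of homeomorphisms of $M$ which fix every point of the boundary $\partial M$, equipped with the topology of uniform convergence ($C^0$ topology) and with composition as group operation. $\langle g_1,\dots,g_n\rangle$ denotes the generated subgroup, and $\mathrm{Homeo}_0(M,\partial M)^n$ carries the product topology. *)

(* Defs.v *)
From HB Require Import structures.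
From mathcomp Require Import all_boot all_order all_algebra.
From mathcomp Require Import all_classical all_reals all_analysis.
Import Order.TTheory GRing.Theory Num.Theory.
Import numFieldNormedType.Exports.

Set Implicit Arguments.
Unset Strict Implicit.
Unset Printing Implicit Defensive.

Local Open Scope classical_set_scope.
Local Open Scope ring_scope.

Definition homeomorphism (X Y : topologicalType) (f : X -> Y) : Prop :=
  continuous f /\
  exists g : Y -> X, [/\ continuous g, cancel f g & cancel g f].

Definition homeomorphic (X Y : topologicalType) : Prop :=
  exists f : X -> Y, homeomorphism f.

(* "val i = 0" singles out the first coordinate; when d = 0 there is none and
   the half-space is the one-point space R^0. *)
Definition half_space (R : realType) (d : nat) : set 'rV[R]_d :=
  [set v | forall i : 'I_d, val i = 0%N -> 0 <= v ord0 i].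
Arguments half_space : clear implicits.

(* Subsets used as types carry the subspace topology, and the relatively open
   subsets of H are the sets W `&` H with W open in R^d. *)
Definition locally_homeomorphic_at (R : realType) (d : nat)
    (H : set 'rV[R]_d) (M : topologicalType) (x : M) : Prop :=
  exists (U : set M) (W : set 'rV[R]_d),
    [/\ open U, U x, open W & homeomorphic (set_type U) (set_type (W `&` H))].

Definition manifold_with_boundary (R : realType) (d : nat)
    (M : topologicalType) : Prop :=
  [/\ hausdorff_space M, @second_countable M &
      forall x : M, locally_homeomorphic_at (half_space R d) x].

Definition manifold_interior (R : realType) (d : nat)
    (M : topologicalType) : set M :=
  [set x | locally_homeomorphic_at [set: 'rV[R]_d] x].
Arguments manifold_interior : clear implicits.

Definition manifold_boundary (R : realType) (d : nat)
    (M : topologicalType) : set M := ~` manifold_interior R d M.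
Arguments manifold_boundary : clear implicits.

Definition homeo_rel (M : uniformType) (B : set M) : set {uniform M -> M} :=
  [set g | homeomorphism (g : M -> M) /\ forall x, B x -> g x = x].

(* A compact Hausdorff space has exactly one compatible uniformity, so uniform
   convergence on a compact manifold M does not depend on the one chosen. *)
Definition homeo0 (R : realType) (d : nat) (M : uniformType) :
    set {uniform M -> M} :=
  connected_component (homeo_rel (manifold_boundary R d M)) idfun.
Arguments homeo0 : clear implicits.

Inductive generated_subgroup (T : Type) (S : set (T -> T)) : set (T -> T) :=
| gen_base g : S g -> generated_subgroup S g
| gen_id : generated_subgroup S idfun
| gen_comp g h : generated_subgroup S g -> generated_subgroup S h ->
    generated_subgroup S (g \o h)
| gen_inv g h : generated_subgroup S g -> cancel g h -> cancel h g ->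
    generated_subgroup S h.

Definition nowhere_dense (X : topologicalType) (A : set X) : Prop :=
  (closure A)° = set0.

(* Since 'I_n is finite, pointwise convergence on 'I_n -> _ is the product
   topology on n-tuples. *)
Definition dense_generating_tuples (R : realType) (d : nat) (M : uniformType)
    (n : nat) : set {ptws 'I_n -> set_type (homeo0 R d M)} :=
  [set g | dense [set f : set_type (homeo0 R d M) |
     generated_subgroup (range (fun i => set_val (g i) : M -> M))
                        (set_val f : M -> M)]].
Arguments dense_generating_tuples : clear implicits.

(* Main.v *)
Require Import Defs.
From HB Require Import structures.
From mathcomp Require Import all_boot all_order all_algebra.
From mathcomp Require Import all_classical all_reals all_analysis.
From mathcomp Require Import lra.
Import Order.TTheory GRing.Theory Num.Theory.
Import numFieldNormedType.Exports.

(* In dimension at least 2 every tuple (g_1, ..., g_n) can be perturbed near a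
   boundary point p, which all g_i fix, into a tuple playing ping-pong with
   small disjoint compact sets A_s, one for each letter s = g_i or g_i^-1. The
   ping-pong inclusions are open conditions on the tuple, and they confine the
   orbit of a suitable point to the union of the A_s and a further small set,
   so no tuple satisfying them generates a dense subgroup. The perturbation
   only uses that near p the group of homeomorphisms supported in a half ball
   is multi-transitive on finite sets (here dimension at least 2 enters) and
   can shrink small balls arbitrarily. In dimension 0 there is no boundary, and
   in dimension 1 an arc starting at p can be prolonged chart by chart until it
   fills M, so M is a closed interval. *)

Set Implicit Arguments.
Unset Strict Implicit.
Unset Printing Implicit Defensive.

Local Open Scope classical_set_scope.
Local Open Scope ring_scope.

(** * Homeomorphisms isotopic to the identity *)

(** The boundary point matters because every [g_i] fixes it: a small neighbourhood [W] of [p] and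
    its images under the [g_i] are all small, so composing the [g_i] with arbitrary homeomorphisms
    supported in [W] is a small change for uniform convergence, however violent it is inside [W].
    The inclusions for the inverse letters are stated contrapositively, as inclusions for [g_i]
    itself. Every ping-pong condition then sends a compact set into an open one, which is an open
    condition on the tuple. Membership in the identity component comes from explicit isotopies
    [w + t *: eta w] in a chart, where [eta] has Lipschitz constant below 1: each stage is a
    homeomorphism by the Banach fixed point theorem. The boundary is the complement of the set of
    interior points, and a chart directly shows only that points over the open half-space are
    interior. Hence all supports lie over the open half-space, and in dimension 1 the openness of
    the images of [[0, s[] is an invariant of the growing arc. *)

Lemma open_nbhs_of (X : topologicalType) (A : set X) (x : X) :
  open A -> A x -> nbhs x A.
Proof. by move=> oA Ax; exact: open_nbhs_nbhs. Qed.

Lemma nbhs_uniformP (M : uniformType) (f : {uniform M -> M})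
    (P : set {uniform M -> M}) :
  nbhs f P <->
  exists2 E, entourage E & forall h : M -> M, (forall x, E (f x, h x)) -> P h.
Proof.
rewrite uniform_nbhs; split=> [[E [entE EP]]|[E entE EP]]; exists E => //.
  by move=> h fh; apply: EP => x _; exact: fh.
by split=> // h fh; apply: EP => x; exact: fh.
Qed.

Lemma open_entourageP (M : uniformType) (x : M) (V : set M) :
  nbhs x V <-> exists2 E, entourage E & forall y, E (x, y) -> V y.
Proof.
rewrite -nbhs_entourageE; split=> [[E entE EV]|[E entE EV]]; exists E => //.
  by move=> y Exy; apply: EV; rewrite /xsection/= inE.
by move=> y; rewrite /xsection/= inE => /EV.
Qed.

(** Each point of [K] has a neighbourhood which all maps close to [f] send into [V]; compactness
    makes the closeness uniform over [K]. This is the source of the stability of ping-pong. *)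
Lemma near_uniform_maps_into (M : uniformType) (f : {uniform M -> M})
    (K V : set M) :
  continuous (f : M -> M) -> compact K -> open V -> f @` K `<=` V ->
  \forall h \near f, (h : M -> M) @` K `<=` V.
Proof.
move=> cf cK oV fKV.
have /compact_near_coveringP near_K := cK.
have FF : Filter (nbhs f) by exact: nbhs_filter.
have near_f := near_K _ _ (fun (h : {uniform M -> M}) x => V (h x)) FF.
suff /near_f {near_f} : forall x, K x ->
    \forall x' \near x & h \near f, V ((h : {uniform M -> M}) x').
  move=> near_fV; refine (@filterS _ _ FF _ _ _ near_fV).
  by move=> h KV _ [x Kx <-]; exact: KV.
move=> x Kx.
have : nbhs (f x) V by apply: open_nbhs_of => //; apply: fKV; exists x.
move=> /open_entourageP[E entE EV].
exists ([set x' | split_ent E (f x, f x')],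
        [set h : {uniform M -> M} | forall y, split_ent E (f y, h y)]).
  split=> /=.
    have /(cf x) : nbhs (f x) [set y | split_ent E (f x, y)].
      by apply/open_entourageP; exists (split_ent E).
    exact.
  by apply/nbhs_uniformP; exists (split_ent E).
move=> [x' h] /= [xx' fh]; apply: EV.
exact: (entourage_split (f x')).
Qed.

(** Right translations are continuous for uniform convergence whatever [h] is; the group structure
    of the identity component is derived from them. *)
Lemma precomp_continuous (M : uniformType) (h : M -> M) :
  continuous (fun f : {uniform M -> M} => (f \o h : {uniform M -> M})).
Proof.
move=> f P /nbhs_uniformP[E entE EP]; apply/nbhs_uniformP; exists E => // k fk.
by apply: EP => x; exact: fk.
Qed.

Lemma homeomorphism_id (X : topologicalType) : homeomorphism (@idfun X).
Proof. by split=> [x //|]; exists idfun; split => // x. Qed.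

Lemma homeomorphism_comp (X Y Z : topologicalType) (f : Y -> Z) (g : X -> Y) :
  homeomorphism f -> homeomorphism g -> homeomorphism (f \o g).
Proof.
move=> [cf [f' [cf' fK f'K]]] [cg [g' [cg' gK g'K]]].
have comp_cont (A B C : topologicalType) (u : B -> C) (v : A -> B) :
  continuous u -> continuous v -> continuous (u \o v).
  by move=> cu cv x; apply: continuous_comp; [exact: cv|exact: cu].
split; first exact: comp_cont.
exists (g' \o f'); split; first exact: comp_cont.
- exact: can_comp.
- exact: can_comp.
Qed.

Section Homeo0.
Context {R : realType} {d : nat} {M : uniformType}.
Local Notation B := (manifold_boundary R d M).
Local Notation H := (homeo0 R d M).

Lemma homeo_rel_comp (f g : M -> M) :
  homeo_rel B f -> homeo_rel B g -> homeo_rel B (f \o g).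
Proof.
move=> [hf fB] [hg gB]; split; first exact: homeomorphism_comp.
by move=> x Bx /=; rewrite (gB x Bx) (fB x Bx).
Qed.

Lemma homeo0_sub : H `<=` homeo_rel B.
Proof. exact: connected_component_sub. Qed.

Lemma homeo_rel_id : homeo_rel B idfun.
Proof. by split=> //; exact: homeomorphism_id. Qed.

Lemma homeo0_id : H idfun.
Proof. exact/connected_component_refl/homeo_rel_id. Qed.

(** Right translation by [h] maps the connected set [H] onto a connected set of homeomorphisms
    fixing the boundary. Taking [f] or [g] to be the identity yields closure under composition and
    inverses. *)
Lemma homeo0_precomp_component (f g h : M -> M) :
  H f -> H g -> homeo_rel B h ->
  connected_component (homeo_rel B) (f \o h : {uniform M -> M}) (g \o h).
Proof.
move=> Hf Hg Bh.
apply: (@connected_component_max _ _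
  [set (k \o h : {uniform M -> M}) | k in H]).
- by exists f.
- by move=> _ [k Hk <-]; apply: homeo_rel_comp => //; exact: homeo0_sub.
- apply: connected_continuous_connected; first exact: component_connected.
  by apply: continuous_subspaceT; exact: precomp_continuous.
- by exists g.
Qed.

Lemma homeo0_comp (f h : M -> M) : H f -> H h -> H (f \o h).
Proof.
move=> Hf Hh.
have := homeo0_precomp_component homeo0_id Hf (homeo0_sub Hh).
exact: connected_component_trans Hh.
Qed.

Lemma homeo0_inv (f h : M -> M) : H f -> cancel f h -> cancel h f -> H h.
Proof.
move=> Hf fK hK; have [[cf [f' [cf' fK' f'K]]] fB] := homeo0_sub Hf.
have hf' : h = f' by apply/funext => x; rewrite -{1}(f'K x) fK.
have Bh : homeo_rel B h.
  split; last by move=> x Bx; rewrite -{1}(fB x Bx) fK.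
  by split; [rewrite hf'|exists f].
have := homeo0_precomp_component Hf homeo0_id Bh.
by have -> : f \o h = idfun by apply/funext => x /=; exact: hK.
Qed.

Lemma homeo0_isotopy (phi : R -> M -> M) :
  (forall t, 0 <= t <= 1 -> homeo_rel B (phi t)) -> phi 0 = idfun ->
  {within `[0, 1]%classic, continuous (phi : R -> {uniform M -> M})} ->
  H (phi 1).
Proof.
move=> phiB phi0 cphi.
apply: (@connected_component_max _ _
  ((phi : R -> {uniform M -> M}) @` `[0, 1]%classic)).
- by exists 0; [rewrite /= in_itv/= lexx ler01|].
- by move=> _ [t /= + <-]; rewrite in_itv/=; exact: phiB.
- by apply: connected_continuous_connected => //; exact: segment_connected.
- by exists 1; [rewrite /= in_itv/= lexx ler01|].
Qed.

Lemma homeo0_cont {f : M -> M} : H f -> continuous f.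
Proof. by move=> /homeo0_sub[[]]. Qed.

Lemma homeo0_inverse {f : M -> M} :
  H f -> exists2 h, H h & cancel f h /\ cancel h f.
Proof.
move=> Hf; have [[_ [h [_ fK hK]]] _] := homeo0_sub Hf.
by exists h; [exact: (homeo0_inv Hf)|].
Qed.

Definition supported_homeo (Y : set M) : set (M -> M) :=
  [set f | H f /\ forall x, ~ Y x -> f x = x].

Lemma supported_homeoS (Y Z : set M) :
  Y `<=` Z -> supported_homeo Y `<=` supported_homeo Z.
Proof. by move=> YZ f [Hf fY]; split=> // x Zx; apply: fY => /YZ. Qed.

Lemma supported_homeo_id (Y : set M) : supported_homeo Y idfun.
Proof. by split=> //; exact: homeo0_id. Qed.

Lemma supported_homeo_comp (Y : set M) (f g : M -> M) :
  supported_homeo Y f -> supported_homeo Y g -> supported_homeo Y (f \o g).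
Proof.
move=> [Hf fY] [Hg gY]; split; first exact: homeo0_comp.
by move=> x Yx /=; rewrite (gY _ Yx) (fY _ Yx).
Qed.

Lemma supported_homeo_inv (Y : set M) (f : M -> M) : supported_homeo Y f ->
  exists2 h, supported_homeo Y h & cancel f h /\ cancel h f.
Proof.
move=> [Hf fY]; have [h Hh [fK hK]] := homeo0_inverse Hf.
by exists h => //; split=> // x Yx; rewrite -{1}(fY _ Yx) fK.
Qed.

Lemma supported_homeo_in (Y : set M) (f : M -> M) (x : M) :
  supported_homeo Y f -> Y x -> Y (f x).
Proof.
move=> fS Yx; apply: contrapT => Yfx.
have [h hS [fK _]] := supported_homeo_inv fS.
by have := hS.2 _ Yfx; rewrite fK => xfx; apply: Yfx; rewrite -xfx.
Qed.

End Homeo0.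

(** * Ping-pong and flexible open sets *)

Lemma open_maps_point_into (M : uniformType) (x : M) (V : set M) : open V ->
  open [set f : {uniform M -> M} | V (f x)].
Proof.
move=> oV; rewrite openE => f Vfx.
have : nbhs (f x) V by apply: open_nbhs_of.
move=> /open_entourageP[E entE EV]; apply/nbhs_uniformP; exists E => // h fh.
by apply: EV; exact: fh.
Qed.

Section PingPong.
Context {R : realType} {d : nat} {M : uniformType} {n : nat}.
Local Notation H := (homeo0 R d M).

(* The letter (i, true) stands for g_i and (i, false) for its inverse; every
   set except A (i, false) is attracted into A (i, true) by g_i, and every set
   except A (i, true) is attracted into A (i, false) by the inverse of g_i.
   The index None is that of a set containing the starting point. *)
Definition ping_pong (A : option ('I_n * bool) -> set M) (g : 'I_n -> M -> M) :=
  forall i t,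
    (t <> Some (i, false) -> g i @` A t `<=` (A (Some (i, true)))°) /\
    (t <> Some (i, true) -> g i @` (~` (A (Some (i, false)))°) `<=` ~` A t).

Definition letter_act (g h : 'I_n -> M -> M) (s : 'I_n * bool) : M -> M :=
  if s.2 then g s.1 else h s.1.

(** The images of [x] under reduced words. The index records the letter applied last, [None] for the
    empty word, and the side condition excludes cancellation with the next letter. *)
Inductive reduced_orbit (g h : 'I_n -> M -> M) (x : M) :
    option ('I_n * bool) -> M -> Prop :=
| reduced_orbit_start : reduced_orbit g h x None x
| reduced_orbit_step s t y : reduced_orbit g h x t y ->
    t <> Some (s.1, ~~ s.2) ->
    reduced_orbit g h x (Some s) (letter_act g h s y).

Context (g h : 'I_n -> M -> M) (x : M).
Hypothesis gK : forall i, cancel (g i) (h i).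
Hypothesis hK : forall i, cancel (h i) (g i).

Lemma letter_actK s y :
  letter_act g h (s.1, ~~ s.2) (letter_act g h s y) = y.
Proof. by case: s => i [] /=; rewrite /letter_act/= ?gK ?hK. Qed.

Lemma reduced_orbit_act s t y : reduced_orbit g h x t y ->
  exists t', reduced_orbit g h x t' (letter_act g h s y).
Proof.
move=> oty; have [tE|ts] := pselect (t = Some (s.1, ~~ s.2)); last first.
  by exists (Some s); apply: reduced_orbit_step ts.
case: oty tE => [//|s' t' y' oty' _ [s's]].
exists t'; suff -> : letter_act g h s (letter_act g h s' y') = y' by [].
by rewrite -[RHS](letter_actK s') s's /= negbK; case: (s).
Qed.

(** An equivalence holding for every [y] lets the induction pass to inverses: the hypothesis on [f1]
    is read at the point [f2 y]. *)
Lemma reduced_orbit_generated (f : M -> M) :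
  generated_subgroup (range g) f -> forall y,
  (exists t, reduced_orbit g h x t y) <-> (exists t, reduced_orbit g h x t (f y)).
Proof.
elim=> [_ [i _ <-]|//|f1 f2 _ IH1 _ IH2|f1 f2 _ IH f1K f2K] y.
- split=> -[t]; first exact: (@reduced_orbit_act (i, true)).
  by move=> /(@reduced_orbit_act (i, false)); rewrite /letter_act/= gK.
- by rewrite IH2 IH1.
- by rewrite (IH (f2 y)) f2K.
Qed.

(** For an inverse letter one argues by contraposition: a point [h i y'] outside the interior of
    [A (Some (i, false))] would be sent by [g i] outside the set containing [y']. *)
Lemma reduced_orbit_ping_pong (A : option ('I_n * bool) -> set M) t y :
  ping_pong A g -> A None x -> reduced_orbit g h x t y -> A t y.
Proof.
move=> pp Ax; elim=> [//|[i []] t' y' _ At'y' /= t's].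
  by apply: interior_subset; apply: (pp i t').1 => //; exists y'.
rewrite /letter_act/=; apply: interior_subset; apply: contrapT => Ahy'.
by apply: ((pp i t').2 t's _ _ At'y'); exists (h i y'); rewrite ?hK.
Qed.

(** The maps sending [x] into [V] form an open set, nonempty because of [f0], while the group orbit
    of [x] stays in the union of the sets [A t], which misses [V]. *)
Lemma ping_pong_not_dense (A : option ('I_n * bool) -> set M) (V : set M)
    (f0 : M -> M) :
  ping_pong A g -> A None x -> open V -> (forall t, V `&` A t = set0) ->
  H f0 -> V (f0 x) ->
  ~ dense [set f : set_type H | generated_subgroup (range g) (set_val f : M -> M)].
Proof.
move=> pp Ax oV VA Hf0 Vf0 /(_ [set f : set_type H | V ((set_val f : M -> M) x)]).
case.
- exists (exist _ (f0 : {uniform M -> M}) (mem_set Hf0)).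
  by rewrite /= set_valE.
- have := open_maps_point_into x oV => oVx.
  by exists [set f : {uniform M -> M} | V (f x)].
move=> f [Vfx /reduced_orbit_generated/(_ x)[+ _]] => /(_ _)[|t].
  by exists None; exact: reduced_orbit_start.
move=> /(reduced_orbit_ping_pong pp Ax) Atfx.
by have : (V `&` A t) (set_val f x) by []; rewrite VA.
Qed.

End PingPong.

(** * Flexible open sets and transitivity of supported homeomorphisms *)

Section Flexible.
Context {R : realType} {d : nat} {M : uniformType}.
Local Notation B := (manifold_boundary R d M).
Local Notation H := (homeo0 R d M).
Local Notation supp := (@supported_homeo R d M).

(** The properties of an open half ball on which the perturbation rests: connectedness after removal
    of finitely many points, absence of isolated points, local homogeneity, and shrinking. In the
    last clause [P] precedes [Q] because the target [Q] will depend on maps constructed from [P]. *)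
Definition flexible (Y : set M) : Prop :=
  [/\ open Y /\ (forall F : seq M, connected (Y `\` [set` F])),
      forall (y : M) (N : set M), Y y -> nbhs y N ->
        exists2 z, N z & z != y,
      forall (y : M) (N : set M), Y y -> nbhs y N ->
        \forall z \near y, exists2 f, supp N f & f y = z &
      forall (y : M) (N : set M), Y y -> nbhs y N ->
        exists2 P, nbhs y P &
          forall Q, nbhs y Q -> exists2 f, supp N f & f @` P `<=` Q].

(** [U] stands for the part of a ball lying in the closed half-space and [Y] for its part in the
    open half-space; [p] need not lie in [Y]. *)
Definition flexible_near (p : M) : Prop :=
  forall W, nbhs p W -> exists U Y,
    [/\ open U, U p, U `<=` W & [/\ Y `<=` U, U `<=` closure Y & flexible Y]].

Hypothesis M_hausdorff : hausdorff_space M.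

Lemma open_setD_seq (Y : set M) (F : seq M) : open Y -> open (Y `\` [set` F]).
Proof.
move=> oY; apply: openI => //; rewrite openC.
have /accessible_finite_set_closed := hausdorff_accessible M_hausdorff.
by apply; exact: finite_seq.
Qed.

(** Local homogeneity makes the orbit of [x] under homeomorphisms supported in [Z], and its
    complement in [Z], both open; [Z] is connected. *)
Lemma flexible_transitive (Y : set M) (F : seq M) (x y : M) :
  flexible Y -> Y x -> Y y -> x \notin F -> y \notin F ->
  exists2 f, supp (Y `\` [set` F]) f & f x = y.
Proof.
move=> [[oY cY] _ homY _] Yx Yy xF yF.
set Z := Y `\` [set` F]; have oZ : open Z by exact: open_setD_seq.
have Zx : Z x by split=> //; exact/negP.
have Zy : Z y by split=> //; exact/negP.
have near_orbit z : Z z -> \forall z' \near z, exists2 f, supp Z f & f z = z'.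
  by move=> Zz; apply: homY (Zz.1) _; apply: open_nbhs_of.
pose O := [set z | exists2 f, supp Z f & f x = z].
suff ZO : Z `&` O = Z by have [] : (Z `&` O) y by rewrite ZO.
apply: (cY F).
- by exists x; split=> //; exists idfun => //; exact: supported_homeo_id.
- exists O => //; rewrite openE => _ [f fS <-].
  have /near_orbit : Z (f x) := supported_homeo_in fS Zx.
  apply: filterS => z [f' f'S <-]; exists (f' \o f) => //.
  exact: supported_homeo_comp.
- exists (~` (Z `\` O)); last first.
    apply/seteqP; split=> z [Zz Oz]; split=> //.
      by case.
    by apply: contrapT => nO; apply: Oz.
  rewrite closedC openE => z [Zz Oz].
  have := near_orbit z Zz.
  apply: filterS2 (open_nbhs_of oZ Zz) => z' Zz' [f fS fz].
  split=> // -[f' f'S f'x]; apply: Oz.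
  have [h hS [fK hK]] := supported_homeo_inv fS.
  exists (h \o f'); first exact: supported_homeo_comp.
  by rewrite /= f'x -fz fK.
Qed.

Lemma flexible_multitransitive (Y : set M) (s : seq (M * M)) :
  flexible Y -> uniq (map fst s) -> uniq (map snd s) ->
  (forall q, q \in s -> Y q.1 /\ Y q.2) ->
  exists2 f, supp Y f & forall q, q \in s -> f q.1 = q.2.
Proof.
move=> flexY; elim: s => [_ _ _|[x y] s IH /= /andP[xs us1] /andP[ys us2] sY].
  by exists idfun => //; exact: supported_homeo_id.
have [|f fS fs] := IH us1 us2; first by move=> q qs; apply: sY; rewrite inE qs orbT.
have [h _ [fK _]] := supported_homeo_inv fS.
have [Yx Yy] := sY (x, y) (mem_head _ _).
have fxs : f x \notin map snd s.
  apply/negP => /mapP[q qs /esym]; rewrite -(fs q qs) => /(can_inj fK) qx.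
  by move/negP: xs; apply; rewrite -qx; exact: map_f.
(* The correction [k] is supported away from the targets already reached, so it does not disturb
   them. *)
have [k kS kx] := flexible_transitive flexY (supported_homeo_in fS Yx) Yy fxs ys.
exists (k \o f).
  by apply: supported_homeo_comp => //; apply: supported_homeoS kS => z [].
move=> q; rewrite inE => /orP[/eqP -> //|qs] /=.
rewrite (fs q qs) kS.2// => -[_] /=; apply.
exact: map_f.
Qed.

Lemma flexible_open_infinite (Y N : set M) (F : seq M) :
  flexible Y -> open N -> N `<=` Y -> N !=set0 ->
  exists2 x, N x & x \notin F.
Proof.
move=> [_ perf _ _]; elim: F N => [|a F IH] N oN NY [y Ny]; first by exists y.
have [|||x [Nx xa] xF] := IH (N `\` [set` [:: a]]).
- exact: open_setD_seq.
- by move=> z [/NY].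
- have [ya|ya] := eqVneq y a; last first.
    by exists y; split=> //=; rewrite inE; exact/negP.
  have [|z Nz zy] := perf y N (NY _ Ny); first exact: open_nbhs_of.
  by exists z; split=> //=; rewrite inE -ya; exact/negP.
- exists x => //; rewrite inE negb_or xF andbT; apply/negP => xa'.
  by apply: xa; rewrite /= inE.
Qed.

Lemma flexible_injection (T : finType) (Y N : set M) (F : seq M) :
  flexible Y -> open N -> N `<=` Y -> N !=set0 ->
  exists c : T -> M, injective c /\ forall t, N (c t) /\ c t \notin F.
Proof.
move=> flexY oN NY N0; have [x0 _] := N0.
have [s [us ss sNF]] : exists s : seq M, [/\ uniq s, size s = #|T| &
    forall x, x \in s -> N x /\ x \notin F].
  elim: #|T| => [|m [s [us ss sNF]]]; first by exists [::].
  have [x Nx] := flexible_open_infinite (F ++ s) flexY oN NY N0.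
  rewrite mem_cat negb_or => /andP[xF xs].
  exists (x :: s); split=> /=; [by rewrite xs|by rewrite ss|].
  by move=> y; rewrite inE => /orP[/eqP ->|/sNF].
exists (fun t => nth x0 s (enum_rank t)); split.
  move=> t u /eqP; rewrite nth_uniq ?ss ?ltn_ord//.
  by move=> /eqP/val_inj/enum_rank_inj.
by move=> t; apply: sNF; rewrite mem_nth// ss ltn_ord.
Qed.

Lemma hausdorff_disjoint_nbhs (T : finType) (a : T -> M) (N : set M) :
  injective a -> (forall t, nbhs (a t) N) ->
  exists V : T -> set M,
    [/\ forall t, nbhs (a t) (V t), forall t, V t `<=` N &
        forall t u, t != u -> V t `&` V u = set0].
Proof.
move=> ainj aN.
have /choice[W WP] : forall tu : T * T, exists W : set M * set M,
    tu.1 != tu.2 -> [/\ nbhs (a tu.1) W.1, nbhs (a tu.2) W.2 &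
                        W.1 `&` W.2 = set0].
  move=> [t u] /=; have [_|tu] := eqVneq t u; first by exists (set0, set0).
  have atu : a t != a u by apply: contra_neq tu => /ainj.
  move: M_hausdorff; rewrite open_hausdorff => /(_ _ _ atu).
  move=> [W [/set_mem tW /set_mem uW] [oW1 oW2 /eqP W0]].
  by exists W => _; split=> //; exact: open_nbhs_of.
exists (fun t => N `&`
  [set x | forall u, t != u -> (W (t, u)).1 x /\ (W (u, t)).2 x]); split.
- move=> t; apply: filterI => //; apply: filter_forall => u.
  have [tu|tu] := eqVneq t u; first by apply: nearW.
  have [W1 _ _] := WP (t, u) tu.
  have [|_ W2 _] := WP (u, t); first by rewrite /= eq_sym.
  by apply: filterS2 W1 W2 => x; split.
- by move=> t x [].
- move=> t u tu; rewrite -subset0 => x [[_ /(_ u tu)[W1 _]]].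
  move=> [_ /(_ t)]; rewrite eq_sym => /(_ tu)[_ W2].
  by have [_ _ <-] := WP (t, u) tu.
Qed.

End Flexible.
Arguments flexible R d {M} Y.
Arguments flexible_near R d {M} p.

(** * Perturbation into ping-pong position *)

Section Perturbation.
Context {R : realType} {d : nat} {M : uniformType} {n : nat}.
Local Notation B := (manifold_boundary R d M).
Local Notation H := (homeo0 R d M).
Local Notation supp := (@supported_homeo R d M).
Hypothesis M_hausdorff : hausdorff_space M.
Hypothesis M_compact : compact [set: M].

Lemma homeo0_preimage_nbhs (g : M -> M) (y : M) (N : set M) :
  H g -> nbhs (g y) N -> nbhs y (g @^-1` N).
Proof. by move=> Hg; exact: (homeo0_cont Hg). Qed.

Lemma homeo0_preimage_open (g : M -> M) (N : set M) :
  H g -> open N -> open (g @^-1` N).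
Proof.
move=> Hg; rewrite !openE => oN y Ngy; exact/(homeo0_preimage_nbhs Hg)/oN.
Qed.

Lemma homeo0_family_inverse (g : 'I_n -> M -> M) : (forall i, H (g i)) ->
  exists h : 'I_n -> M -> M,
    forall i, [/\ H (h i), cancel (g i) (h i) & cancel (h i) (g i)].
Proof.
move=> Hg; suff /choice[h hP] : forall i, exists k : M -> M,
    [/\ H k, cancel (g i) k & cancel k (g i)] by exists h.
by move=> i; have [k Hk [gK kK]] := homeo0_inverse (Hg i); exists k.
Qed.

(* Without invariance of domain the points of U outside Y are not known to be
   boundary points; they are avoided by a density argument. *)
Lemma open_mapped_into (g : 'I_n -> M -> M) (p : M) (U Y : set M) :
  (forall i, H (g i)) -> (forall i, g i p = p) -> open U -> U p ->
  open Y -> U `<=` closure Y ->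
  exists N, [/\ open N, N !=set0, N `<=` Y & forall i, g i @` N `<=` Y].
Proof.
move=> Hg gp oU Up oY UY.
have [h hP] := homeo0_family_inverse Hg.
suff [N [oN N0 NY _ gN]] : exists N, [/\ open N, N !=set0, N `<=` Y,
    forall i, g i @` N `<=` U & forall i, i \in enum 'I_n -> g i @` N `<=` Y].
  by exists N; split=> // i; apply: gN; rewrite mem_enum.
elim: (enum 'I_n) => [|i s [N [oN [y Ny] NY gU gs]]].
  pose V := [set x | forall i, U (g i x)].
  have pV : nbhs p V.
    apply: filter_forall => i; apply: homeo0_preimage_nbhs => //.
    by rewrite gp; exact: open_nbhs_of.
  exists (Y `&` V°); split=> //.
  - by apply: openI => //; exact: open_interior.
  - by apply: (UY _ Up); exact: nbhs_interior.
  - by move=> i _ [x [_ /interior_subset Vx] <-].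
have [Hh gK hK] := hP i.
have [z [Yz Nhz]] : Y `&` h i @^-1` N !=set0.
  apply: UY; first by apply: (gU i); exists y.
  apply: homeo0_preimage_nbhs => //; rewrite gK; exact: open_nbhs_of.
exists (N `&` g i @^-1` Y); split.
- by apply: openI => //; exact: homeo0_preimage_open.
- by exists (h i z); split=> //=; rewrite hK.
- by move=> x [/NY].
- by move=> j _ [x [Nx _] <-]; apply: gU; exists x.
- move=> j; rewrite inE => /orP[/eqP -> _ [x [_ gx] <-] //|js].
  by move=> _ [x [Nx _] <-]; apply: (gs j js); exists x.
Qed.

Lemma small_nbhs (g : 'I_n -> M -> M) (p : M) (D : set (M * M)) :
  (forall i, H (g i)) -> (forall i, g i p = p) -> entourage D ->
  exists2 W, nbhs p W & (forall x y, W x -> W y -> D (x, y)) /\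
    forall i x y, W x -> W y -> D (g i x, g i y).
Proof.
move=> Hg gp entD; pose W := [set y | split_ent D (p, y) /\ split_ent D (y, p)].
have WD x y : W x -> W y -> D (x, y).
  by move=> [_ xp] [py _]; exact: (entourage_split p).
have pW : nbhs p W.
  rewrite -nbhs_entourageE; exists (split_ent D `&` ((split_ent D)^-1)%relation).
    apply: filterI; first exact: entourage_split_ent.
    exact/entourage_inv/entourage_split_ent.
  by move=> y; rewrite /xsection/= inE => -[].
exists (W `&` [set y | forall i, W (g i y)]).
  apply: filterI => //; apply: filter_forall => i.
  by apply: homeo0_preimage_nbhs => //; rewrite gp.
by split=> [x y [Wx _] [Wy _]|i x y [_ Wx] [_ Wy]]; exact: WD.
Qed.

Lemma supported_close (D : set (M * M)) (Y : set M) (f : M -> M) (x : M) :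
  entourage D -> (forall y z, Y y -> Y z -> D (y, z)) -> supp Y f ->
  D (x, f x).
Proof.
move=> entD YD fS; have [Yx|Yx] := pselect (Y x).
  by apply: YD => //; exact: supported_homeo_in fS Yx.
by rewrite (fS.2 _ Yx); exact: entourage_refl.
Qed.

(* After post-composition with f, the map g sends every base point a t into C
   and its inverse sends every base point into C'. *)
Lemma ping_pong_points (T : finType) (g : M -> M) (Y N C C' : set M)
    (a : T -> M) :
  H g -> flexible R d Y -> N `<=` Y -> g @` N `<=` Y ->
  injective a -> (forall t, N (a t)) ->
  open C -> C `<=` N -> C !=set0 -> open C' -> C' `<=` N -> C' !=set0 ->
  exists2 f, supp Y f & forall t,
    C (f (g (a t))) /\ exists2 c', C' c' & f (g c') = a t.
Proof.
move=> Hg flexY NY gN ainj aN oC CN C0 oC' C'N C'0.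
have [h _ [gK _]] := homeo0_inverse Hg; have ginj := can_inj gK.
have [c [cinj cP]] := flexible_injection M_hausdorff T (codom a) flexY oC
  (subset_trans CN NY) C0.
have [c' [c'inj c'P]] := flexible_injection M_hausdorff T (codom a) flexY oC'
  (subset_trans C'N NY) C'0.
(* One application of multi-transitivity serves both requirements: the sources are distinct since
   the [c' t] avoid the base points and [g] is injective, the targets since the [c t] avoid the base
   points. *)
pose s := [seq (g (a t), c t) | t <- index_enum T] ++
          [seq (g (c' t), a t) | t <- index_enum T].
have [|||f fS fs] := flexible_multitransitive M_hausdorff (s := s) flexY.
- rewrite /s map_cat -!map_comp cat_uniq; apply/and3P; split.
  + by rewrite map_inj_uniq ?index_enum_uniq// => t u /ginj/ainj.
  + apply/hasPn => _ /mapP[t _ ->] /=; apply/negP => /mapP[u _ /= /ginj c'a].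
    by have [_] := c'P t; rewrite c'a codom_f.
  + by rewrite map_inj_uniq ?index_enum_uniq// => t u /ginj/c'inj.
- rewrite /s map_cat -!map_comp cat_uniq; apply/and3P; split.
  + by rewrite map_inj_uniq ?index_enum_uniq.
  + apply/hasPn => _ /mapP[t _ ->] /=; apply/negP => /mapP[u _ /= ac].
    by have [_] := cP u; rewrite -ac codom_f.
  + by rewrite map_inj_uniq ?index_enum_uniq.
- move=> q; rewrite mem_cat => /orP[] /mapP[t _ ->] /=; split.
  + by apply: gN; exists (a t).
  + by have [/CN/NY] := cP t.
  + by apply: gN; exists (c' t) => //; have [/C'N] := c'P t.
  + exact/NY/aN.
exists f => // t; split.
  have /fs -> : (g (a t), c t) \in s.
    by rewrite mem_cat map_f ?mem_index_enum.
  by have [] := cP t.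
exists (c' t); first by have [] := c'P t.
by rewrite (fs (g (c' t), a t))// mem_cat orbC map_f ?mem_index_enum.
Qed.

(** The new map is [g i] followed by [f i], which places base points correctly, and flanked by
    shrinking maps [s (i, true)] and [s' (i, false)]. The latter live in disjoint sets [V], so each
    is the identity on the sets [A t] of the other letters. *)
Lemma ping_pong_perturbation (g : 'I_n -> M -> M) (p : M) (E : set (M * M)) :
  (forall i, H (g i)) -> B p -> flexible_near R d p -> entourage E ->
  exists g' : 'I_n -> M -> M,
    [/\ forall i, H (g' i), forall i x, E (g i x, g' i x) &
      exists A x V f0, [/\ ping_pong A g', forall t, compact (A t),
        A None x, open V & [/\ forall t, V `&` A t = set0, H f0 & V (f0 x)]]].
Proof.
move=> Hg Bp flexp entE; set D := split_ent E.
have gp i : g i p = p by apply: (homeo0_sub (Hg i)).2.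
have entD : entourage D by exact: entourage_split_ent.
have entD2 : entourage (split_ent D) by exact: entourage_split_ent.
have [W pW [WD gWD]] := small_nbhs Hg gp entD2.
have [U [Y [oU Up UW [YU UY flexY]]]] := flexp W pW.
have oY : open Y by case: flexY => -[].
have YW x : Y x -> W x by move=> /YU/UW.
have [N [oN [y0 Ny0] NY gN]] := open_mapped_into Hg gp oU Up oY UY.
(* One base point per letter, one for the start of the orbit ([Some None]), and one around which the
   missed open set lies ([None]). *)
have [a [ainj aN]] := flexible_injection M_hausdorff
  (option (option ('I_n * bool))) [::] flexY oN NY (ex_intro _ y0 Ny0).
have {}aN t : N (a t) by have [] := aN t.
have [V [aV VN VV]] := hausdorff_disjoint_nbhs M_hausdorff ainj
  (fun t => open_nbhs_of oN (aN t)).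
have aY t : Y (a t) by exact/NY/aN.
have VY t : V t `<=` Y by exact: subset_trans (VN t) NY.
have /choice[P PP] : forall s, exists P, nbhs (a (Some (Some s))) P /\
    forall Q, nbhs (a (Some (Some s))) Q ->
      exists2 f, supp (V (Some (Some s))) f & f @` P `<=` Q.
  move=> s; case: flexY => _ _ _ shrink.
  by have [P aP PQ] := shrink _ _ (aY (Some (Some s))) (aV _); exists P.
pose C s := (P s `&` V (Some (Some s)))°.
have aC s : C s (a (Some (Some s))).
  by apply: filterI => //; exact: (PP s).1.
have CN s : C s `<=` N by move=> x /interior_subset[_ /VN].
have CP s : C s `<=` P s by move=> x /interior_subset[].
have oC s : open (C s) by exact: open_interior.
have /choice[f fP] : forall i, exists f, supp Y f /\ forall t,
    C (i, true) (f (g i (a (Some t)))) /\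
    exists2 c', C (i, false) c' & f (g i c') = a (Some t).
  move=> i.
  have asinj : injective (a \o some) by move=> t u /= /ainj[].
  have [||f fS fP] := ping_pong_points (Hg i) flexY NY (gN i) asinj
    (fun t => aN (Some t)) (oC (i, true)) (CN _) _ (oC (i, false)) (CN _).
  - by exists (a (Some (Some (i, true)))).
  - by exists (a (Some (Some (i, false)))).
  by exists f.
pose k i := f i \o g i.
have Hk i : H (k i) by apply: homeo0_comp => //; exact: (fP i).1.1.
have [h hP] := homeo0_family_inverse Hk.
(* The sets [A t] are chosen only now, after [P] and [k]: by continuity, a small closed
   neighbourhood of the base point is sent into [P (i, true)] by every [k i] and into [P (i, false)]
   by every inverse [h i]. *)
have /choice[A AP] : forall t, exists A, [/\ nbhs (a (Some t)) A, closed A,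
    A `<=` V (Some t), forall i, k i @` A `<=` P (i, true) &
    forall i, h i @` A `<=` P (i, false)].
  move=> t; pose Z := V (Some t) `&` [set x | forall i,
    P (i, true) (k i x) /\ P (i, false) (h i x)].
  have aZ : nbhs (a (Some t)) Z.
    apply: filterI => //; apply: filter_forall => i.
    have [Hh kK hK] := hP i; have [fC [c' C'c' fc']] := (fP i).2 t.
    apply: filterI; apply: homeo0_preimage_nbhs => //.
      by apply: filterS (CP _) _; exact: open_nbhs_of.
    rewrite -fc' -[f i (g i c')]/(k i c') kK.
    by apply: filterS (CP _) _; exact: open_nbhs_of.
  have [A aA AZ] := compact_regular M_hausdorff M_compact filterT aZ.
  exists (closure A); split.
  - by apply: filterS aA; exact: subset_closure.
  - exact: closed_closure.
  - by move=> x /AZ[].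
  - by move=> i _ [x /AZ[_ /(_ i)[+ _]] <-].
  - by move=> i _ [x /AZ[_ /(_ i)[_ +]] <-].
have /choice[s sP] : forall l, exists s,
    supp (V (Some (Some l))) s /\ s @` P l `<=` (A (Some l))°.
  move=> l; have [aA _ _ _ _] := AP (Some l).
  by have [s sS sP] := (PP l).2 _ (nbhs_interior aA); exists s.
have /choice[s' s'P] : forall l, exists s',
    [/\ supp (V (Some (Some l))) s', cancel (s l) s' & cancel s' (s l)].
  by move=> l; have [s' s'S [sK s'K]] := supported_homeo_inv (sP l).1; exists s'.
have suppY l u : supp (V (Some (Some l))) u -> supp Y u.
  exact: supported_homeoS.
have AV t x l : A t x -> t <> Some l -> ~ V (Some (Some l)) x.
  move=> Atx tl Vx; have [_ _ AtV _ _] := AP t.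
  have tl' : Some t != Some (Some l) by apply/eqP => -[].
  have : (V (Some t) `&` V (Some (Some l))) x by split=> //; exact: AtV.
  by rewrite VV.
pose g' i := s (i, true) \o k i \o s' (i, false).
exists g'; split.
- move=> i; apply: homeo0_comp; last by have [[]] := s'P (i, false).
  by apply: homeo0_comp => //; exact: (sP _).1.1.
(* The values [g i x] and [g' i x] are compared through [g i z] and [k i z]. Each of the three moves
   either is trivial or takes place inside [Y] or its image under [g i], which are small. *)
- move=> i x; set z := s' (i, false) x.
  have DY y z' : Y y -> Y z' -> split_ent D (y, z') by move=> /YW Wy /YW; exact: WD.
  have [sS _ _] := s'P (i, false).
  apply: (entourage_split (g i z)) => //.
    have [Yx|Yx] := pselect (Y x).
      apply: split_ent_subset => //; apply: gWD; apply: YW => //.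
      exact: supported_homeo_in (suppY _ _ sS) Yx.
    by rewrite /z (suppY _ _ sS).2//; exact: entourage_refl.
  apply: (entourage_split (k i z)) => //.
    exact: (supported_close (g i z) entD2 DY (fP i).1).
  exact: (supported_close (k i z) entD2 DY (suppY _ _ (sP (i, true)).1)).
exists A, (a (Some None)), (V None)°.
have [f0 f0S f0a] := flexible_transitive M_hausdorff flexY (aY (Some None))
  (aY None) (isT : _ \notin [::]) (isT : _ \notin [::]).
exists f0; split.
- move=> i t; have [_ _ AtV kA hA] := AP t; have [Hh kK hK] := hP i.
  split=> [ti|ti _ [x Ax <-] Agx].
    move=> _ [x Ax <-]; apply: (sP (i, true)).2.
    have [s'S _ _] := s'P (i, false).
    exists (k i x); first by apply: kA; exists x.
    by rewrite /g' /= (s'S.2 x)//; exact: AV Ax ti.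
  (* If [g' i x] were in [A t], then [s (i, true)] would fix it, so [h i] would carry it to
     [s' (i, false) x], a point of [P (i, false)]; applying [s (i, false)] puts [x] in the interior
     that it avoids. *)
  apply: Ax; apply: (sP (i, false)).2.
  have [_ _ s'K] := s'P (i, false).
  have [sS sK _] := s'P (i, true).
  have s1 : s (i, true) (g' i x) = g' i x.
    by rewrite (sP (i, true)).1.2//; exact: AV Agx ti.
  exists (h i (g' i x)); first by apply: hA; exists (g' i x).
  by rewrite -[g' i x]sK s1 /g' /= sK kK s'K.
- move=> t; have [_ Acl _ _ _] := AP t.
  exact: (subclosed_compact Acl M_compact).
- by apply: nbhs_singleton; have [] := AP None.
- exact: open_interior.
- split.
  + move=> t; rewrite -subset0 => x [/interior_subset Vx].
    have [_ _ AtV _ _] := AP t => /AtV Vtx.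
    by rewrite -(VV None (Some t)).
  + exact: f0S.1.
  + by rewrite f0a; exact: nbhs_singleton (nbhs_interior _).
Qed.

End Perturbation.

(** * The topology on tuples *)

Section TupleTopology.
Context {M : uniformType} {n : nat} (H : set {uniform M -> M}).
Local Notation tuples := {ptws 'I_n -> set_type H}.
Implicit Types g h : tuples.

(** The product topology is a supremum of initial topologies, so it suffices that the filter of
    uniform boxes converges to [g] in each coordinate. *)
Lemma nbhs_tuple_entourage g (P : set tuples) : nbhs g P ->
  exists2 E, entourage E &
    forall h, (forall i x, E ((set_val (g i) : M -> M) x, (set_val (h i) : M -> M) x)) ->
      P h.
Proof.
pose F := filter_from entourage (fun E => [set h : tuples | forall i x,
  E ((set_val (g i) : M -> M) x, (set_val (h i) : M -> M) x)]).
suff /[apply] : F --> g by [].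
have FF : Filter F.
  apply: filter_from_filter; first by exists setT; exact: filterT.
  move=> E1 E2 entE1 entE2; exists (E1 `&` E2); first exact: filterI.
  by move=> h hE; split=> i x; have [] := hE i x.
apply/cvg_sup => i U [_ [[V [W oW <-] <-]] /= Wgi] WU.
have /nbhs_uniformP[E entE EW] : nbhs (set_val (g i) : {uniform M -> M}) W.
  exact: open_nbhs_of.
by exists E => // h gh; apply: WU => /=; apply: EW => x; exact: gh.
Qed.

Lemma nbhs_tuple_coordinatewise g (Q : 'I_n -> set {uniform M -> M}) :
  (forall i, nbhs (set_val (g i) : {uniform M -> M}) (Q i)) ->
  nbhs g [set h | forall i, Q i (set_val (h i))].
Proof.
move=> gQ; have FF : Filter (nbhs g) by exact: nbhs_filter.
refine (@filter_forall _ _ (fun i h => Q i (set_val (h i))) _ FF _) => i.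
have gQi : nbhs (g i) (set_val @^-1` Q i).
  exact: (@initial_continuous _ _ set_val (g i) _ (gQ i)).
exact: (@proj_continuous _ (fun=> set_type H) i g _ gQi).
Qed.

End TupleTopology.

(** * Stability of ping-pong and nowhere density *)

Section Conclusion.
Context {R : realType} {d : nat} {M : uniformType} {n : nat}.
Local Notation B := (manifold_boundary R d M).
Local Notation H := (homeo0 R d M).
Hypothesis M_hausdorff : hausdorff_space M.
Hypothesis M_compact : compact [set: M].

Lemma ping_pong_near (A : option ('I_n * bool) -> set M)
    (g : {ptws 'I_n -> set_type H}) :
  (forall t, compact (A t)) ->
  ping_pong A (fun i => set_val (g i) : M -> M) ->
  \forall h \near g, ping_pong A (fun i => set_val (h i) : M -> M).
Proof.
move=> cA ppg; apply: (nbhs_tuple_coordinatewise (Q := fun i =>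
  [set f : {uniform M -> M} | forall t,
    (t <> Some (i, false) -> (f : M -> M) @` A t `<=` (A (Some (i, true)))°) /\
    (t <> Some (i, true) ->
      (f : M -> M) @` (~` (A (Some (i, false)))°) `<=` ~` A t)])) => i.
have cgi : continuous (set_val (g i) : M -> M).
  exact: homeo0_cont (set_mem (svalP (g i))).
have FF : Filter (nbhs (set_val (g i) : {uniform M -> M})) by exact: nbhs_filter.
refine (@filter_forall _ _ (fun t (f : {uniform M -> M}) =>
  (t <> Some (i, false) -> (f : M -> M) @` A t `<=` (A (Some (i, true)))°) /\
  (t <> Some (i, true) ->
    (f : M -> M) @` (~` (A (Some (i, false)))°) `<=` ~` A t)) _ FF _) => t.
apply: (@filterI _ _ FF).
  have [ti|ti] := pselect (t = Some (i, false)); first by apply: (@nearW _ _ _ FF) => f /(_ ti).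
  have := near_uniform_maps_into cgi (cA t) (@open_interior _ _) ((ppg i t).1 ti).
  by apply: (@filterS _ _ FF) => f fA.
have [ti|ti] := pselect (t = Some (i, true)); first by apply: (@nearW _ _ _ FF) => f /(_ ti).
(* This is where the contrapositive form pays off: the complement of an interior is closed, hence
   compact in [M], and the complement of the compact [A t] is open. *)
have cK : compact (~` (A (Some (i, false)))°).
  apply: (subclosed_compact _ M_compact) => //.
  by rewrite closedC; exact: open_interior.
have oA : open (~` A t) by rewrite openC; exact: compact_closed.
have := near_uniform_maps_into cgi cK oA ((ppg i t).2 ti).
by apply: (@filterS _ _ FF) => f fA.
Qed.

(** A tuple interior to the closure of [Omega] could be perturbed inside that closure to a ping-pong
    tuple. Ping-pong persists on a neighbourhood, which must then meet [Omega], against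
    [ping_pong_not_dense]. *)
Lemma dense_generating_tuples_nowhere_dense (p : M) : B p -> flexible_near R d p ->
  exists C : set {ptws 'I_n -> set_type H},
    [/\ closed C, nowhere_dense C & dense_generating_tuples R d M n `<=` C].
Proof.
move=> Bp flexp; set Omega := dense_generating_tuples R d M n.
exists (closure Omega); split; [exact: closed_closure| |exact: subset_closure].
rewrite /nowhere_dense -(closure_id _).1; last exact: closed_closure.
rewrite -subset0 => g /nbhs_tuple_entourage[E entE EOmega].
have Hval (f : set_type H) : H (set_val f) by exact: set_mem (svalP f).
have [g' [Hg' gg' [A [x [V [f0 [ppg' cA Ax oV [VA Hf0 Vf0]]]]]]]] :=
  ping_pong_perturbation M_hausdorff M_compact (fun i => Hval (g i)) Bp flexp entE.
pose k : {ptws 'I_n -> set_type H} :=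
  fun i => exist _ (g' i : {uniform M -> M}) (mem_set (Hg' i)).
have kE i : (set_val (k i) : M -> M) = g' i by rewrite set_valE.
have /EOmega Omegak : forall i x,
  E ((set_val (g i) : M -> M) x, (set_val (k i) : M -> M) x) by move=> i y; rewrite kE.
have [|k' [Omegak' ppk']] := Omegak _ (ping_pong_near cA _ : nbhs k _).
  by under [X in ping_pong _ X]funext do rewrite kE.
have [h hP] := homeo0_family_inverse (fun i => Hval (k' i)).
have hK i : cancel (h i) (set_val (k' i) : M -> M) by have [] := hP i.
have kK i : cancel (set_val (k' i) : M -> M) (h i) by have [] := hP i.
exact: (ping_pong_not_dense kK hK ppk' Ax oV VA Hf0 Vf0 Omegak').
Qed.

End Conclusion.

(** * Charts *)

Definition to_set_type (X : Type) (A : set X) (x : X) (Ax : A x) :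
  set_type A := exist _ x (mem_set Ax).

Lemma set_val_to_set_type (X : Type) (A : set X) (x : X) (Ax : A x) :
  set_val (to_set_type Ax) = x.
Proof. by rewrite set_valE. Qed.

Section Charts.
Context {R : realType} {d : nat} {M : topologicalType}.
Implicit Types (Hs W : set 'rV[R]_d) (U : set M).

(* A homeomorphism between an open U and W `&` Hs, as total functions whose
   values outside these sets are junk. *)
Definition chart Hs W U (psi : 'rV[R]_d -> M) (kap : M -> 'rV[R]_d) : Prop :=
  [/\ open U, open W,
      forall x, U x -> [/\ W (kap x), Hs (kap x) & psi (kap x) = x],
      forall v, W v -> Hs v -> U (psi v) /\ kap (psi v) = v &
      (forall x, U x -> forall N, nbhs (kap x) N -> nbhs x (kap @^-1` N)) /\
      (forall v, W v -> Hs v -> forall N, nbhs (psi v) N ->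
         \forall w \near v, Hs w -> N (psi w))].

Lemma nbhs_set_type (X : topologicalType) (A : set X) (x : set_type A)
    (P : set (set_type A)) :
  nbhs x P -> exists2 V, nbhs (set_val x) V & forall y, V (set_val y) -> P y.
Proof.
move=> [_ [[V oV <-] /= Vx] VP]; exists V; first exact: open_nbhs_of.
by move=> y /VP.
Qed.

Lemma continuous_set_val_at (X Y : topologicalType) (A : set X) (B : set Y)
    (f : set_type A -> set_type B) (x : set_type A) (N : set Y) :
  continuous f -> nbhs (set_val (f x)) N ->
  \forall z \near set_val x, forall y, set_val y = z -> N (set_val (f y)).
Proof.
move=> cf fxN.
have fxN' : nbhs (f x) (set_val @^-1` N).
  exact: (@initial_continuous _ _ set_val (f x) _ fxN).
have [V xV VN] := nbhs_set_type (cf x _ fxN').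
by apply: filterS xV => z Vz y yz; apply: VN; rewrite yz.
Qed.

Lemma locally_homeomorphic_chart Hs (x : M) : locally_homeomorphic_at Hs x ->
  exists W U psi kap, U x /\ chart Hs W U psi kap.
Proof.
move=> [U [W [oU Ux oW [F [cF [G [cG FK GK]]]]]]].
pose psi v := if pselect ((W `&` Hs) v) is left WHv
  then set_val (G (to_set_type WHv)) else x.
pose kap y := if pselect (U y) is left Uy
  then set_val (F (to_set_type Uy)) else 0.
have psiE (w : set_type (W `&` Hs)) : psi (set_val w) = set_val (G w).
  rewrite /psi; case: pselect => [WHw|[]]; last exact: set_mem (svalP w).
  by congr (set_val (G _)); exact: val_inj.
have kapE (y : set_type U) : kap (set_val y) = set_val (F y).
  rewrite /kap; case: pselect => [Uy|[]]; last exact: set_mem (svalP y).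
  by congr (set_val (F _)); exact: val_inj.
have lift (X : topologicalType) (A : set X) y : A y ->
    exists z : set_type A, set_val z = y.
  by move=> Ay; exists (to_set_type Ay); rewrite set_val_to_set_type.
have memA (X : topologicalType) (A : set X) (z : set_type A) : A (set_val z).
  exact: set_mem (svalP z).
exists W, U, psi, kap; split=> //; split=> //.
- move=> _ /lift[y <-]; rewrite kapE psiE FK.
  by have [] := memA _ _ (F y).
- move=> v Wv Hv; have [w <-] := lift _ (W `&` Hs) v (conj Wv Hv).
  by rewrite psiE kapE GK; split=> //; exact: memA.
split=> [_ /lift[y <-] N|v Wv Hv N].
  rewrite kapE => /(continuous_set_val_at cF) near_N.
  have near_U : nbhs (set_val y) U by apply: open_nbhs_of => //; exact: memA.
  apply: filterS2 near_N near_U => z zN /lift[z' zz'] /=.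
  by rewrite -zz' kapE; exact: zN.
have [w <-] := lift _ (W `&` Hs) v (conj Wv Hv).
rewrite psiE => /(continuous_set_val_at cG) near_N.
have near_W : nbhs (set_val w) W.
  by apply: open_nbhs_of => //; have [] := memA _ _ w.
apply: filterS2 near_N near_W => z zN Wz Hz.
have [z' zz'] := lift _ (W `&` Hs) z (conj Wz Hz).
by rewrite -zz' psiE; exact: zN.
Qed.

(** Changing [Hs] to [Hs'] turns a half-space chart, restricted over the open half-space, into a
    chart modelled on the whole of [R^d]. *)
Lemma chart_restrict Hs Hs' W W' U psi kap : chart Hs W U psi kap ->
  open W' -> W' `<=` W -> W' `&` Hs = W' `&` Hs' ->
  chart Hs' W' (U `&` kap @^-1` W') psi kap.
Proof.
move=> [oU oW UP WP [ck cp]] oW' W'W HH'.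
have HtoH' v : W' v -> Hs v <-> Hs' v.
  move=> Wv; split=> Hv.
    by have [] : (W' `&` Hs') v by rewrite -HH'.
  by have [] : (W' `&` Hs) v by rewrite HH'.
split=> //.
- rewrite openE => x [Ux W'x]; apply: filterI; first exact: open_nbhs_of.
  by apply: ck => //; exact: open_nbhs_of.
- move=> x [Ux W'x]; have [Wx Hx xE] := UP x Ux.
  by split=> //; apply/HtoH'.
- move=> v W'v /(HtoH' _ W'v) Hv; have [Uv vE] := WP v (W'W _ W'v) Hv.
  by split=> //; split=> //=; rewrite vE.
split=> [x [Ux _]|v W'v /(HtoH' _ W'v) Hv N vN]; first exact: ck.
apply: filterS2 (cp v (W'W _ W'v) Hv N vN) (open_nbhs_of oW' W'v).
by move=> w wN W'w /(HtoH' _ W'w).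
Qed.

(** Ensures that homeomorphisms supported in such a chart fix the boundary pointwise. *)
Lemma chart_interior W U psi kap :
  chart setT W U psi kap -> U `<=` manifold_interior R d M.
Proof.
move=> [oU oW UP WP [ck cp]] x Ux; exists U, W; split=> //.
have memU (y : set_type U) : U (set_val y) by exact: set_mem (svalP y).
have memW (w : set_type (W `&` setT)) : W (set_val w).
  by have [] := set_mem (svalP w).
have Fin (y : set_type U) : (W `&` setT) (kap (set_val y)).
  by have [Wy _ _] := UP _ (memU y).
have Gin (w : set_type (W `&` setT)) : U (psi (set_val w)).
  by have [] := WP _ (memW w) I.
pose F (y : set_type U) : set_type (W `&` setT) := to_set_type (Fin y).
pose G (w : set_type (W `&` setT)) : set_type U := to_set_type (Gin w).
have FE y : set_val (F y) = kap (set_val y) by rewrite set_val_to_set_type.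
have GE w : set_val (G w) = psi (set_val w) by rewrite set_val_to_set_type.
exists F; split.
  move=> y P /nbhs_set_type[V]; rewrite FE => yV VP.
  have yV' := ck _ (memU y) _ yV.
  have yV2 := @initial_continuous _ _ set_val y _ yV' : nbhs y _.
  apply: filterS yV2 => z Vz.
  by apply: VP; rewrite FE.
exists G; split.
- move=> w P /nbhs_set_type[V]; rewrite GE => wV VP.
  have wV' := cp _ (memW w) I _ wV.
  have wV2 := @initial_continuous _ _ set_val w _ wV' : nbhs w _.
  apply: filterS wV2 => z Vz.
  by apply: VP; rewrite GE; exact: Vz.
- move=> y; apply: val_inj; rewrite -!set_valE GE FE.
  by have [_ _] := UP _ (memU y).
- move=> w; apply: val_inj; rewrite -!set_valE FE GE.
  by have [_] := WP _ (memW w) I.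
Qed.

End Charts.

(** Makes row vectors a complete normed module, as the Banach fixed point theorem requires. *)
HB.instance Definition _ (R : realType) (d : nat) := Complete.on 'rV[R]_d.

Lemma nbhs_norm_ltP (R : realType) (V : normedModType R) (x : V) (P : set V) :
  nbhs x P <-> exists2 r, 0 < r & forall y, `|x - y| < r -> P y.
Proof.
split=> [/nbhs_normP[r r0 rP]|[r r0 rP]]; first by exists r => // y; exact: rP.
by apply/nbhs_normP; exists r => // y; exact: rP.
Qed.

(** Solving [x + eta x = y] means finding the fixed point of the contraction [x |-> y - eta x]. The
    lower bound [expand] gives uniqueness and makes the inverse Lipschitz with constant
    [1 / (1 - k)]. *)
Lemma lipschitz_perturbation (R : realType) (V : completeNormedModType R)
    (eta : V -> V) (k : R) : 0 <= k < 1 ->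
  (forall x y, `|eta x - eta y| <= k * `|x - y|) ->
  exists h : V -> V, [/\ continuous h, cancel (fun x => x + eta x) h &
    cancel h (fun x => x + eta x)].
Proof.
move=> /andP[k0 k1] lip.
have expand x y : (1 - k) * `|x - y| <= `|(x + eta x) - (y + eta y)|.
  have -> : (x + eta x) - (y + eta y) = (x - y) + (eta x - eta y).
    by rewrite opprD addrACA.
  have := lerB_normD (x - y) (eta x - eta y); have := lip x y; lra.
have /choice[h hK] : forall y, exists x, x + eta x = y.
  move=> y; pose f := totalfun (fun x => y - eta x).
  have ctrf : is_contraction f.
    exists (NngNum k0); split=> // -[x z] _ /=.
    by rewrite opprB addrC subrKA distrC; exact: lip.
  have [x _ xE] := banach_fixed_point ctrf closedT (ex_intro _ 0 I).
  by exists x; rewrite {1}xE /= subrK.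
have hinj : cancel (fun x => x + eta x) h.
  move=> x; apply/eqP; rewrite -subr_eq0 -normr_eq0.
  have := expand (h (x + eta x)) x; rewrite hK subrr normr0.
  have := normr_ge0 (h (x + eta x) - x).
  by move=> n0 ?; rewrite eq_le n0 andbT; nra.
exists h; split=> // y N /nbhs_norm_ltP[r r0 rN].
apply/nbhs_norm_ltP; exists ((1 - k) * r); first by nra.
move=> z yz; apply: rN; have := expand (h y) (h z); rewrite !hK => ?.
rewrite -(ltr_pM2l (x := 1 - k)); last by lra.
exact: le_lt_trans yz.
Qed.

(** * Supported homeomorphisms from Lipschitz perturbations *)

Section Transfer.
Context {R : realType} {d : nat} {M : uniformType}.
Local Notation B := (manifold_boundary R d M).
Local Notation supp := (@supported_homeo R d M).
Hypothesis M_hausdorff : hausdorff_space M.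
Context (O : set 'rV[R]_d) (Y : set M) (psi : 'rV[R]_d -> M)
  (kap : M -> 'rV[R]_d).
Hypothesis chartY : chart setT O Y psi kap.
Implicit Types (h : 'rV[R]_d -> 'rV[R]_d) (K : set 'rV[R]_d).

Definition transfer h (x : M) : M := if pselect (Y x) then psi (h (kap x)) else x.

Lemma transfer_in h x : Y x -> transfer h x = psi (h (kap x)).
Proof. by rewrite /transfer; case: pselect. Qed.

Lemma transfer_out h x : ~ Y x -> transfer h x = x.
Proof. by rewrite /transfer; case: pselect. Qed.

Lemma chart_in x : Y x -> O (kap x) /\ psi (kap x) = x.
Proof. by case: chartY => _ _ YP _ _ /YP[]. Qed.

Lemma chart_out v : O v -> Y (psi v) /\ kap (psi v) = v.
Proof. by case: chartY => _ _ _ OP _ /OP; exact. Qed.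

Lemma chart_kap_near x N : Y x -> nbhs (kap x) N -> nbhs x (kap @^-1` N).
Proof. by case: chartY => _ _ _ _ [+ _] Yx; exact. Qed.

Lemma chart_psi_near v N : O v -> nbhs (psi v) N -> nbhs v (psi @^-1` N).
Proof.
by case: chartY => _ _ _ _ [_ cp] Ov /(cp v Ov I); apply: filterS => w; exact.
Qed.

Lemma transfer_supportedE h K x : (forall w, ~ K w -> h w = w) ->
  ~ (psi @` K) x -> transfer h x = x.
Proof.
move=> hK Kx; have [Yx|] := pselect (Y x); last exact: transfer_out.
have [Ox xE] := chart_in Yx.
rewrite transfer_in// hK// => Kkap; apply: Kx.
by exists (kap x).
Qed.

Lemma chart_compact K : compact K -> K `<=` O -> compact (psi @` K).
Proof.
move=> cK KO; apply: continuous_compact => //.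
apply: continuous_in_subspaceT => v /set_mem Kv N.
by apply: chart_psi_near; exact: KO.
Qed.

Lemma transfer_continuous h K : continuous h -> compact K -> K `<=` O ->
  (forall w, ~ K w -> h w = w) -> (forall w, O w -> O (h w)) ->
  continuous (transfer h).
Proof.
move=> ch cK KO hK hO x N; have [Yx|nYx] := pselect (Y x).
  rewrite /= transfer_in// => xN; have [Ox xE] := chart_in Yx.
  have oY : open Y by case: chartY.
  have xN' := chart_kap_near Yx (ch _ _ (chart_psi_near (hO _ Ox) xN)).
  apply: filterS2 xN' (open_nbhs_of oY Yx) => z zN Yz /=.
  by rewrite transfer_in.
have Kx : (~` (psi @` K)) x.
  by move=> [v /KO Ov vx]; apply: nYx; rewrite -vx; exact: (chart_out Ov).1.
rewrite transfer_out// => xN.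
have oK : open (~` (psi @` K)).
  rewrite openC; apply: compact_closed => //; exact: chart_compact.
apply: filterS2 xN (open_nbhs_of oK Kx) => z zN Kz /=.
by rewrite (transfer_supportedE hK Kz).
Qed.

Lemma transfer_comp h g : (forall w, O w -> O (g w)) ->
  transfer h \o transfer g = transfer (h \o g).
Proof.
move=> gO; apply/funext => x /=.
have [Yx|nYx] := pselect (Y x); last by rewrite !(transfer_out _ nYx).
have [Ogx] := chart_out (gO _ (chart_in Yx).1).
by rewrite (transfer_in g Yx) (transfer_in _ Yx) (transfer_in _ Ogx) => -> .
Qed.

Lemma transfer_id : transfer id = idfun.
Proof.
apply/funext => x; have [Yx|] := pselect (Y x); last exact: transfer_out.
by rewrite transfer_in//; have [] := chart_in Yx.
Qed.

Lemma transfer_homeomorphism h h' K : continuous h -> continuous h' ->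
  cancel h h' -> cancel h' h -> compact K -> K `<=` O ->
  (forall w, ~ K w -> h w = w) ->
  homeomorphism (transfer h) /\ (forall w, K w -> K (h w)).
Proof.
move=> ch ch' hh' h'h cK KO hK.
have h'K w : ~ K w -> h' w = w by move=> /hK; move=> {1}<-.
have stable f f' w : cancel f f' -> (forall w, ~ K w -> f w = w) -> K w -> K (f w).
  move=> ff' fK Kw; apply: contrapT => nKw.
  have ffw := can_inj ff' (fK _ nKw).
  by apply: nKw; rewrite ffw.
have stableO f f' w : cancel f f' -> (forall w, ~ K w -> f w = w) -> O w -> O (f w).
  move=> ff' fK Ow; have [Kw|/fK -> //] := pselect (K w).
  by apply: KO; exact: stable ff' fK Kw.
have hO w : O w -> O (h w) := stableO _ _ w hh' hK.
have h'O w : O w -> O (h' w) := stableO _ _ w h'h h'K.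
split; last by move=> w; exact: stable hh' hK.
split; first exact: transfer_continuous ch cK KO hK hO.
exists (transfer h'); split; first exact: transfer_continuous ch' cK KO h'K h'O.
- move=> x; rewrite -[LHS]/((transfer h' \o transfer h) x) transfer_comp//.
  by rewrite (_ : h' \o h = id) ?transfer_id//; apply/funext => w /=; exact: hh'.
- move=> x; rewrite -[LHS]/((transfer h \o transfer h') x) transfer_comp//.
  by rewrite (_ : h \o h' = id) ?transfer_id//; apply/funext => w /=; exact: h'h.
Qed.

Lemma closed_ball_norm_compact (v : 'rV[R]_d) (r : R) :
  0 < r -> compact [set w | `|v - w| <= r].
Proof.
move=> r0; have -> : [set w | `|v - w| <= r] = closed_ball v r.
  by rewrite closed_ballE.
apply: bounded_closed_compact; last exact: closed_ball_closed.
rewrite closed_ballE//; exists (`|v| + r); split; first exact: num_real.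
move=> e re w vw; have {}vw : `|v - w| <= r by [].
rewrite -(subKr v w); apply: le_trans (ler_normB _ _) _.
by apply: ltW; apply: le_lt_trans re; rewrite lerD2l.
Qed.

(** Scaling [eta] by [t] in [[0, 1]] keeps the Lipschitz constant at most [k], so the straight-line
    isotopy consists of homeomorphisms, all supported in one compact ball of the chart. *)
Lemma perturbation_supported (eta : 'rV[R]_d -> 'rV[R]_d) (k : R)
    (v : 'rV[R]_d) (r : R) (N : set M) :
  0 <= k < 1 -> (forall x y, `|eta x - eta y| <= k * `|x - y|) -> 0 < r ->
  (forall w, `|v - w| <= r -> O w /\ N (psi w)) ->
  (forall w, r < `|v - w| -> eta w = 0) ->
  supp N (transfer (fun w => w + eta w)).
Proof.
move=> /andP[k0 k1] lip r0 KON eta0.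
set K := [set w | `|v - w| <= r].
have cK : compact K by exact: closed_ball_norm_compact.
have KO : K `<=` O by move=> w /KON[].
pose h (t : R) w := w + t *: eta w.
have hK t w : ~ K w -> h t w = w.
  by move=> /negP; rewrite -ltNge => /eta0; rewrite /h => ->; rewrite scaler0 addr0.
have liph t : 0 <= t <= 1 -> forall x y,
    `|t *: eta x - t *: eta y| <= k * `|x - y|.
  move=> /andP[t0 t1] x y; rewrite -scalerBr normrZ ger0_norm//.
  have := lip x y; have := normr_ge0 (eta x - eta y); nra.
have ceta : continuous eta.
  move=> x P /nbhs_norm_ltP[e e0 eP]; apply/nbhs_norm_ltP; exists e => // y xy.
  by apply: eP; have := lip x y; have := normr_ge0 (x - y); nra.
have ch t : continuous (h t).
  move=> x; apply: cvgD => //; first exact: nbhs_filter.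
  apply: cvgZr => //; first exact: nbhs_filter.
  exact: ceta.
have homeoh t : 0 <= t <= 1 ->
    homeomorphism (transfer (h t)) /\ (forall w, K w -> K (h t w)).
  move=> t01; have [|h' [ch' hh' h'h]] := lipschitz_perturbation _ (liph t t01).
    by rewrite k0 k1.
  exact: (transfer_homeomorphism (ch t) ch' hh' h'h cK KO (hK t)).
have suppN t x : ~ N x -> transfer (h t) x = x.
  move=> Nx; apply: (transfer_supportedE (hK t)) => -[w /KON[_ Nw] wx].
  by apply: Nx; rewrite -wx.
have -> : transfer (fun w => w + eta w) = transfer (h 1).
  by congr transfer; apply/funext => w; rewrite /h scale1r.
split; last exact: suppN.
apply: (homeo0_isotopy (phi := fun t => transfer (h t))).
- move=> t /homeoh[ht _]; split=> // x Bx; apply: transfer_out => Yx.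
  by apply: Bx; exact: chart_interior chartY _ Yx.
- rewrite (_ : h 0 = id) ?transfer_id//.
  by apply/funext => w; rewrite /h scale0r addr0.
(* Uniform convergence as [t] tends to [t0] is a joint-continuity statement at each point of [K],
   made uniform by compactness; off [K] nothing moves. *)
apply: continuous_in_subspaceT => t0 /set_mem; rewrite /= in_itv/= => t01.
move=> P /nbhs_uniformP[E entE EP].
have [_ hK0] := homeoh t0 t01.
have /compact_near_coveringP near_K := cK.
have := near_K R (nbhs t0)
  (fun t w => E (psi (h t0 w), psi (h t w))) (nbhs_filter t0).
case/(_ _)/wrap => [w Kw|near_t].
  set y := psi (h t0 w); have Ohw : O (h t0 w) := KO _ (hK0 w Kw).
  pose Q := [set z | split_ent E (z, y) /\ split_ent E (y, z)].
  have entE' := entourage_split_ent entE.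
  have yQ : nbhs y Q.
    rewrite -nbhs_entourageE; exists (((split_ent E)^-1)%relation `&` split_ent E).
      by apply: filterI => //; exact: entourage_inv.
    by move=> z; rewrite /xsection/= inE.
  have hwQ := chart_psi_near Ohw yQ.
  have ch2 : (fun wt : 'rV[R]_d * R => h wt.2 wt.1) @ (w, t0) --> h t0 w.
    apply: cvgD; first exact: cvg_fst.
    apply: cvgZ; first exact: cvg_snd.
    by apply: (@cvg_comp _ _ _ fst eta _ (nbhs w) _ _ (ceta w)); exact: cvg_fst.
  have near1 := ch t0 w _ hwQ.
  have [[A A'] [/= wA t0A'] AQ] := ch2 _ hwQ.
  exists (A `&` (h t0 @^-1` (psi @^-1` Q)), A').
    by split=> //=; apply: filterI.
  move=> [w' t] /= [[Aw' [Q1 _]] A't]; have [_ Q2] := AQ (w', t) (conj Aw' A't).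
  exact: (entourage_split y).
apply: filterS near_t => t Kt; apply: EP => x.
have [Yx|Yx] := pselect (Y x); last by rewrite !transfer_out//; exact: entourage_refl.
rewrite !transfer_in//; have [Kx|Kx] := pselect (K (kap x)); first exact: Kt.
by rewrite !hK//; exact: entourage_refl.
Qed.

End Transfer.

(** * Row vectors and convex open sets *)

Section RowVectors.
Context {R : realType} {d : nat}.
Implicit Types x y u v w : 'rV[R]_d.

Lemma row_norm_le x (m : R) : 0 <= m -> (forall i, `|x ord0 i| <= m) -> `|x| <= m.
Proof.
move=> m0 xm; rewrite -[`|x|]/(mx_norm x) mx_normrE.
by apply: bigmax_le => // -[i j] _ /=; rewrite (ord1 i).
Qed.

Lemma row_entry_le x i : `|x ord0 i| <= `|x|.
Proof.
rewrite -[`|x|]/(mx_norm x) mx_normrE.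
exact: (le_bigmax _ (fun ij : 'I_1 * 'I_d => `|x ij.1 ij.2|) (ord0, i)).
Qed.

Definition clip (s a : R) := Num.max (- s) (Num.min a s).

(** Joint in both arguments, since in [cutoff] the truncation level varies along with the truncated
    entry. *)
Lemma clip_lipschitz (s t a b m : R) :
  `|s - t| <= m -> `|a - b| <= m -> `|clip s a - clip t b| <= m.
Proof.
rewrite !ler_norml /clip => /andP[st1 st2] /andP[ab1 ab2].
by case: (leP a s); case: (leP b t) => ? ?;
  (case: (leP (- s)); case: (leP (- t)) => ? ?); apply/andP; split; lra.
Qed.

Lemma clip_id (s a : R) : `|a| <= s -> clip s a = a.
Proof.
rewrite ler_norml /clip => /andP[sa as_].
by rewrite (min_idPl as_) (max_idPr sa).
Qed.

Lemma clip0 (a : R) : clip 0 a = 0.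
Proof. by rewrite /clip oppr0; apply: max_idPl; rewrite ge_min lexx orbT. Qed.

Lemma max0_lipschitz (a b : R) : `|Num.max 0 a - Num.max 0 b| <= `|a - b|.
Proof.
have := ler_norm (a - b); have := ler_norm (b - a); rewrite distrC => ? ?.
by rewrite ler_norml; case: (leP 0 a); case: (leP 0 b) => ? ?;
  apply/andP; split; lra.
Qed.

(* In the sup norm this truncation of the identity is 1-Lipschitz, so that
   id - k * cutoff is an explicit homeomorphism contracting a small ball. *)
Definition cutoff (r : R) x : 'rV[R]_d :=
  \row_i clip (Num.max 0 (r - `|x|)) (x ord0 i).

Lemma cutoff_lipschitz r x y : `|cutoff r x - cutoff r y| <= `|x - y|.
Proof.
apply: row_norm_le => // i; rewrite !mxE; apply: clip_lipschitz.
  apply: (le_trans (max0_lipschitz _ _)).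
  have -> : r - `|x| - (r - `|y|) = - (`|x| - `|y|) by lra.
  by rewrite normrN; exact: ler_dist_dist.
by have := row_entry_le (x - y) i; rewrite !mxE.
Qed.

Lemma cutoff_id r x : `|x| <= r / 2 -> cutoff r x = x.
Proof.
move=> xr; apply/rowP => i; rewrite mxE clip_id//.
apply: (le_trans (row_entry_le x i)); rewrite le_max; apply/orP; right; lra.
Qed.

Lemma cutoff_out r x : r <= `|x| -> cutoff r x = 0.
Proof.
move=> rx; apply/rowP => i; rewrite !mxE.
have -> : Num.max 0 (r - `|x|) = 0 by apply: max_idPl; lra.
exact: clip0.
Qed.

Definition segment x y : set 'rV[R]_d :=
  (fun t : R => x + t *: (y - x)) @` `[0, 1]%classic.

Lemma segment_connected_row x y : connected (segment x y).
Proof.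
apply: connected_continuous_connected; first exact: segment_connected.
apply: continuous_subspaceT => t; apply: cvgD; first exact: cvg_cst.
by apply: cvgZl => P.
Qed.

Lemma segment_l x y : segment x y x.
Proof.
by exists 0; rewrite /= ?in_itv/= ?lexx ?ler01// scale0r addr0.
Qed.

Lemma segment_r x y : segment x y y.
Proof.
by exists 1; rewrite /= ?in_itv/= ?lexx ?ler01// scale1r addrC subrK.
Qed.

Lemma avoid_line u f (N : set 'rV[R]_d) w0 : (1 < d)%N -> u != f -> nbhs w0 N ->
  exists w, nbhs w (N `&` [set w | forall t : R, u + t *: (w - u) <> f]).
Proof.
move=> d1 uf w0N; have d0 : (0 < d)%N by exact: ltn_trans d1.
pose i0 := Ordinal d0; pose i1 := Ordinal d1; pose D := f - u.
(* In dimension at least 2 a nonzero linear form [l] kills [f - u]. If [l w] differs from [l u], the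
   line from [u] through [w] misses [f]; otherwise [w0] is shifted along [e], where [l e] is
   nonzero. *)
have [a [b [ab0 abD]]] : exists a b : R,
    a ^+ 2 + b ^+ 2 != 0 /\ a * D ord0 i0 + b * D ord0 i1 = 0.
  have [D0|D0] := eqVneq (D ord0 i0) 0.
    by exists 1, 0; rewrite D0 expr1n expr0n/= addr0 oner_eq0 mulr0 mul0r addr0.
  exists (D ord0 i1), (- D ord0 i0); split; last by lra.
  by rewrite paddr_eq0 ?sqr_ge0// !sqrf_eq0 oppr_eq0 (negbTE D0) andbF.
pose l (x : 'rV[R]_d) : R := a * x ord0 i0 + b * x ord0 i1.
have lD x y : l (x + y) = l x + l y by rewrite /l !mxE; lra.
have lZ t x : l (t *: x) = t * l x by rewrite /l !mxE; lra.
have cl : continuous l.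
  have clZ c i : continuous (fun x : 'rV[R]_d => c * x ord0 i).
    move=> x; apply: cvgMr => //; first exact: nbhs_filter.
    exact: coord_continuous.
  by move=> x; apply: cvgD => //; [exact: nbhs_filter|exact: clZ|exact: clZ].
have lN w : l w != l u -> forall t : R, u + t *: (w - u) <> f.
  move=> wu t /(congr1 (fun z => z - u)); rewrite addrC addKr => tD.
  have : l (t *: (w - u)) = 0 by rewrite tD.
  rewrite lZ -[- u]scaleN1r lD lZ mulN1r => /eqP; rewrite mulf_eq0 subr_eq0.
  rewrite (negbTE wu) orbF => /eqP t0; move: tD; rewrite t0 scale0r => /esym/eqP.
  by rewrite subr_eq0 eq_sym (negbTE uf).
have nearl w : l w != l u -> nbhs w [set w | forall t : R, u + t *: (w - u) <> f].
  move=> wu; have : nbhs (l w) [set c | c != l u] by apply: open_nbhs_of => //; exact: open_neq.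
  move=> /(cl w) near_w; have {}near_w : nbhs w (l @^-1` _) := near_w.
  by apply: filterS near_w => z; exact: lN.
have [w0u|w0u] := eqVneq (l w0) (l u); last first.
  by exists w0; apply: filterI => //; exact: nearl.
pose e := a *: delta_mx ord0 i0 + b *: delta_mx ord0 i1 : 'rV[R]_d.
have le : l e = a ^+ 2 + b ^+ 2.
  by rewrite /l /e !mxE !eqxx/= mulr1 mulr0; lra.
have oN : nbhs w0 N° by exact: nbhs_interior.
have : (w0 + t *: e) @[t --> (0 : R)] --> w0.
  rewrite -[X in _ --> X]addr0 -(scale0r e); apply: cvgD; first exact: cvg_cst.
  by apply: cvgZl => P.
move=> /(_ _ oN)/nbhs_norm_ltP[r r0 rN].
exists (w0 + (r / 2) *: e); apply: filterI.
  by apply: (rN (r / 2)); rewrite sub0r normrN gtr0_norm; lra.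
apply: nearl; rewrite lD lZ le w0u -subr_eq0 addrC addKr mulf_neq0//.
by apply/lt0r_neq0; lra.
Qed.

(** The previous lemma returns a whole neighbourhood of good points, which is what allows it to be
    iterated. *)
Lemma avoid_lines (s : seq ('rV[R]_d * 'rV[R]_d)) (N : set 'rV[R]_d) w0 :
  (1 < d)%N -> (forall q, q \in s -> q.1 != q.2) -> nbhs w0 N ->
  exists2 w, N w & forall q, q \in s -> forall t : R, q.1 + t *: (w - q.1) <> q.2.
Proof.
move=> d1; elim: s N w0 => [|[u f] s IH] N w0 sP w0N.
  by exists w0 => //; exact: nbhs_singleton.
have uf : u != f by exact: (sP (u, f) (mem_head _ _)).
have [w1 w1N] := avoid_line d1 uf w0N.
have [|w [Nw wuf] ws] := IH _ w1 _ w1N.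
  by move=> q qs; apply: sP; rewrite inE qs orbT.
by exists w => // q; rewrite inE => /orP[/eqP ->|/ws].
Qed.

(** Points [u] and [v] are joined by two segments through a generic [w], chosen so that the lines
    from [u] and from [v] to [w] miss [F]. *)
Lemma convex_setD_connected (O : set 'rV[R]_d) (F : seq 'rV[R]_d) :
  (1 < d)%N -> open O -> (forall x y, O x -> O y -> segment x y `<=` O) ->
  connected (O `\` [set` F]).
Proof.
move=> d1 oO cO; set Z := O `\` [set` F].
have [->|/set0P[u Zu]] := eqVneq Z set0; first exact: connected0.
have /choice[C CP] : forall v, exists C,
    Z v -> [/\ connected C, C `<=` Z, C u & C v].
  move=> v; have [Zv|] := pselect (Z v); last by exists set0.
  pose s := [seq (u, f) | f <- F] ++ [seq (v, f) | f <- F].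
  have [||w Ow ws] := @avoid_lines s O u d1.
  - move=> q; rewrite mem_cat => /orP[] /mapP[f fF ->] /=; apply/negP => /eqP ef.
      by apply: Zu.2; rewrite ef.
    by apply: Zv.2; rewrite ef.
  - by apply: open_nbhs_of => //; exact: Zu.1.
  exists (segment u w `|` segment v w) => _; split.
  - apply: connectedU; [|exact: segment_connected_row..].
    by exists w; split; exact: segment_r.
  - move=> z [] zs; (split; first by apply: cO zs => //; first [exact: Zu.1|exact: Zv.1]).
      by case: zs => t _ <- /= uF; apply: (ws (u, u + t *: (w - u)) _ t) => //;
        rewrite mem_cat map_f.
    by case: zs => t _ <- /= uF; apply: (ws (v, v + t *: (w - v)) _ t) => //;
      rewrite mem_cat orbC map_f.
  - by left; exact: segment_l.
  - by right; exact: segment_l.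
have -> : Z = \bigcup_(v in Z) C v.
  apply/seteqP; split=> [v Zv|z [v Zv Cz]].
    by exists v => //; have [_ _ _] := CP v Zv.
  by have [_ + _ _] := CP v Zv; apply.
apply: bigcup_connected; first by exists u => v Zv; have [_ _] := CP v Zv.
by move=> v Zv; have [] := CP v Zv.
Qed.

End RowVectors.

(** * Flexibility near the boundary *)

Section ChartFlexible.
Context {R : realType} {d : nat} {M : uniformType}.
Local Notation supp := (@supported_homeo R d M).
Hypothesis M_hausdorff : hausdorff_space M.
Context (O : set 'rV[R]_d) (Y : set M) (psi : 'rV[R]_d -> M)
  (kap : M -> 'rV[R]_d).
Hypothesis chartY : chart setT O Y psi kap.

Let oY : open Y. Proof. by case: chartY. Qed.
Let oO : open O. Proof. by case: chartY. Qed.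

Lemma chart_ball y (N : set M) : Y y -> nbhs y N ->
  exists2 r, 0 < r & forall w, `|kap y - w| <= r -> O w /\ N (psi w).
Proof.
move=> Yy yN; have [Oy yE] := chart_in chartY Yy.
have : nbhs (kap y) (O `&` psi @^-1` N).
  apply: filterI; first exact: open_nbhs_of.
  by apply: (chart_psi_near chartY Oy); rewrite yE.
move=> /nbhs_norm_ltP[r r0 rN]; exists (r / 2); first lra.
by move=> w wr; apply: rN; lra.
Qed.

Lemma chart_near_ball y (e : R) : Y y -> 0 < e ->
  \forall z \near y, Y z /\ `|kap y - kap z| < e.
Proof.
move=> Yy e0; apply: filterI; first exact: open_nbhs_of.
apply: (chart_kap_near chartY Yy (N := [set w | `|kap y - w| < e])).
by apply/nbhs_norm_ltP; exists e.
Qed.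

Lemma chart_push y (N : set M) : Y y -> nbhs y N ->
  \forall z \near y, exists2 f, supp N f & f y = z.
Proof.
move=> Yy yN; have [r r0 rN] := chart_ball Yy yN.
have [Oy yE] := chart_in chartY Yy.
have := chart_near_ball Yy r0; apply: filterS => z [Yz zr].
have [Oz zE] := chart_in chartY Yz.
set v := kap y in Oy yE rN zr *; set w := kap z in Oz zE zr *.
(* A tent function of radius [r] times the displacement: it equals [w - v] at [v] and has Lipschitz
   constant [r^-1 * |w - v|], below 1 since [z] is near [y]. *)
pose eta x := Num.max 0 (1 - r^-1 * `|v - x|) *: (w - v).
have ri : r * r^-1 = 1 by rewrite mulfV//; lra.
have ri0 : 0 < r^-1 by rewrite invr_gt0.
pose k := r^-1 * `|w - v|.
exists (transfer Y psi kap (fun x => x + eta x)).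
  apply: (perturbation_supported M_hausdorff chartY (k := k) (v := v) (r := r)) => //.
  - rewrite /k mulr_ge0 ?(ltW ri0)//= mulrC ltr_pdivrMr// mul1r distrC.
    exact: zr.
  - move=> x x'; rewrite /eta -scalerBl normrZ /k mulrAC ler_wpM2r//.
    apply: (le_trans (max0_lipschitz _ _)).
    have -> : 1 - r^-1 * `|v - x| - (1 - r^-1 * `|v - x'|) =
              r^-1 * (`|v - x'| - `|v - x|) by lra.
    rewrite normrM (gtr0_norm ri0) ler_wpM2l ?(ltW ri0)//.
    apply: (le_trans (ler_dist_dist _ _)).
    by have -> : v - x' - (v - x) = x - x' by rewrite opprB addrC addrA subrK.
  - move=> x rx; rewrite /eta (_ : Num.max _ _ = 0) ?scale0r//.
    by apply: max_idPl; nra.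
rewrite (transfer_in _ _ _ Yy) -/v /eta subrr normr0 mulr0 subr0.
by rewrite (max_idPr _) ?ler01// scale1r addrC subrK.
Qed.

Lemma chart_shrink y (N : set M) : Y y -> nbhs y N ->
  exists2 P, nbhs y P &
    forall Q, nbhs y Q -> exists2 f, supp N f & f @` P `<=` Q.
Proof.
move=> Yy yN; have [r r0 rN] := chart_ball Yy yN.
have [Oy yE] := chart_in chartY Yy.
have r2 : 0 < r / 2 by lra.
exists [set z | Y z /\ `|kap y - kap z| < r / 2]; first exact: chart_near_ball.
set v := kap y in Oy yE rN *.
move=> Q; rewrite -yE => /(chart_psi_near chartY Oy)/nbhs_norm_ltP[e e0 eQ].
(* On the ball of radius [r / 2] the map is the homothety of ratio [c] about [v], and [c * r <= e]
   places the image within [e] of [v]. That ball is independent of [Q]. *)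
pose c := Num.min (1 / 2) (e / r).
have c0 : 0 < c by rewrite lt_min; apply/andP; split; [lra|exact: divr_gt0].
have c1 : c <= 1 / 2 by rewrite ge_min lexx.
have ce : c * r <= e by rewrite -ler_pdivlMr// ge_min lexx orbT.
exists (transfer Y psi kap (fun x => x + - (1 - c) *: cutoff r (x - v))).
  apply: (perturbation_supported M_hausdorff chartY (k := 1 - c) (v := v) (r := r)) => //.
  - by apply/andP; split; lra.
  - move=> x x'; rewrite -scalerBr normrZ normrN ger0_norm; last lra.
    rewrite ler_wpM2l//; first lra.
    apply: (le_trans (cutoff_lipschitz _ _ _)).
    by rewrite opprB addrA subrK.
  - by move=> x rx; rewrite cutoff_out ?scaler0// distrC ltW.
move=> _ [x [Yx xr] <-]; rewrite (transfer_in _ _ _ Yx); apply: eQ.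
rewrite cutoff_id; last by rewrite distrC ltW.
have -> : v - (kap x + - (1 - c) *: (kap x - v)) = c *: (v - kap x).
  by apply/rowP => i; rewrite !mxE; lra.
rewrite normrZ gtr0_norm//; have := normr_ge0 (v - kap x); nra.
Qed.

Lemma chart_perfect y (N : set M) : (0 < d)%N -> Y y -> nbhs y N ->
  exists2 z, N z & z != y.
Proof.
move=> d0 Yy yN; have [r r0 rN] := chart_ball Yy yN.
pose e : 'rV[R]_d := const_mx r.
have e_neq0 : e != 0.
  apply/eqP => /rowP/(_ (Ordinal d0)); rewrite !mxE => re0; lra.
have [|Ow Nw] := rN (kap y - e).
  by rewrite subKr; apply: row_norm_le => [|i]; [lra|rewrite mxE gtr0_norm].
exists (psi (kap y - e)) => //; apply/eqP => /(congr1 kap).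
rewrite (chart_out chartY Ow).2 => /eqP.
by rewrite -subr_eq0 addrC addKr oppr_eq0 (negbTE e_neq0).
Qed.

Lemma chart_flexible : (1 < d)%N ->
  (forall x y, O x -> O y -> segment x y `<=` O) -> flexible R d Y.
Proof.
move=> d1 cO; split.
- split=> // F; pose F' := [seq kap x | x <- F & `[< Y x >]].
  have -> : Y `\` [set` F] = psi @` (O `\` [set` F']).
    apply/seteqP; split=> [x [Yx xF]|_ [v [Ov vF'] <-]].
      have [Ox xE] := chart_in chartY Yx.
      exists (kap x) => //; split=> //= /mapP[z]; rewrite mem_filter.
      move=> /andP[/asboolP Yz zF] xz; apply: xF => /=.
      by rewrite -xE xz (chart_in chartY Yz).2.
    have [Yv vE] := chart_out chartY Ov; split=> // vF; apply: vF' => /=.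
    apply/mapP; exists (psi v) => //; rewrite mem_filter; apply/andP; split=> //.
    exact/asboolP.
  apply: connected_continuous_connected; first exact: convex_setD_connected.
  apply: continuous_in_subspaceT => v /set_mem[Ov _] N.
  by apply: (chart_psi_near chartY); exact: Ov.
- by move=> y N; apply: chart_perfect; exact: ltn_trans d1.
- exact: chart_push.
- exact: chart_shrink.
Qed.

End ChartFlexible.

Section BoundaryFlexible.
Context {R : realType} {d : nat} {M : uniformType}.
Hypothesis M_hausdorff : hausdorff_space M.

Lemma open_first_coordinate_gt0 (i : 'I_d) :
  open [set v : 'rV[R]_d | 0 < v ord0 i].
Proof.
have c : continuous (fun v : 'rV[R]_d => v ord0 i) by move=> v; exact: coord_continuous.
exact: (open_comp (fun v _ => c v) (@open_gt R 0)).
Qed.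

Lemma segment_ball (v x y : 'rV[R]_d) (r : R) :
  `|v - x| < r -> `|v - y| < r -> forall z, segment x y z -> `|v - z| < r.
Proof.
move=> vx vy z [t /=]; rewrite in_itv/= => /andP[t0 t1] <-.
have -> : v - (x + t *: (y - x)) = (1 - t) *: (v - x) + t *: (v - y).
  by apply/rowP => i; rewrite !mxE; lra.
apply: (le_lt_trans (ler_normD _ _)); rewrite !normrZ !ger0_norm; [|lra..].
have [t0'|t0'] := eqVneq t 0; first by rewrite t0'; lra.
have {t0'}t0 : 0 < t by rewrite lt_neqAle eq_sym t0'.
nra.
Qed.

Lemma half_space_flexible_near (p : M) : (1 < d)%N ->
  locally_homeomorphic_at (half_space R d) p -> flexible_near R d p.
Proof.
move=> d1 /locally_homeomorphic_chart[W [U0 [psi [kap [U0p ch0]]]]] N pN.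
have d0 : (0 < d)%N by exact: ltn_trans d1.
pose i0 := Ordinal d0; set Hs := half_space R d in ch0.
have [oU0 oW U0P WP [ck cp]] := ch0.
have [Wp Hp pE] := U0P _ U0p.
have : nbhs (kap p) (W `&` [set w | Hs w -> N (psi w)]).
  by apply: filterI; [exact: open_nbhs_of|apply: cp => //; rewrite pE].
move=> /nbhs_norm_ltP[r r0 rWN].
pose W1 := [set w : 'rV[R]_d | `|kap p - w| < r].
have oW1 : open W1.
  have -> : W1 = ball (kap p) r by rewrite -ball_normE.
  exact: ball_open.
have W1W : W1 `<=` W by move=> w /rWN[].
pose O := W1 `&` [set v : 'rV[R]_d | 0 < v ord0 i0].
have oO : open O by apply: openI => //; exact: open_first_coordinate_gt0.
have OH : O `&` Hs = O `&` setT.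
  apply/seteqP; split=> w [Ow _] //; split=> // i i0E.
  by have -> : i = i0; [exact: val_inj|apply: ltW; have [] := Ow].
have ch1 := chart_restrict ch0 oW1 W1W (erefl (W1 `&` Hs)).
have chY := chart_restrict ch0 oO (fun w Ow => W1W _ Ow.1) OH.
exists (U0 `&` kap @^-1` W1), (U0 `&` kap @^-1` O); split.
- by case: ch1.
- by split=> //=; rewrite /W1/= subrr normr0.
- move=> x [U0x /rWN[_]]; have [_ Hx xE] := U0P _ U0x.
  by move=> /(_ Hx); rewrite xE.
split; first by move=> x [U0x []].
- move=> x [U0x W1x] V xV; have [_ Hx xE] := U0P _ U0x.
  have : nbhs (kap x) (W1 `&` [set w | Hs w -> V (psi w)]).
    apply: filterI; first exact: open_nbhs_of.
    by apply: cp; [exact: W1W| |rewrite xE].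
  move=> /nbhs_norm_ltP[e e0 eV].
  (* Pushing every coordinate up by [e / 2] enters the open half-space while moving less than [e] in
     the sup norm. *)
  pose w : 'rV[R]_d := kap x + const_mx (e / 2).
  have [|W1w Vw] := eV w.
    rewrite /w opprD addrA subrr add0r normrN.
    apply: (@le_lt_trans _ _ (e / 2)); last lra.
    by apply: row_norm_le => [|i]; [lra|rewrite mxE gtr0_norm//; lra].
  have Hw : Hs w by move=> i iE; rewrite !mxE; have := Hx i iE; lra.
  have Ow : O w.
    by split=> //=; rewrite !mxE; have := Hx i0 erefl; lra.
  have [Yw _] := chart_out chY Ow.
  by exists (psi w); split=> //; exact: Vw.
apply: (chart_flexible M_hausdorff chY d1) => x y [Wx x0] [Wy y0] z xyz.
split; first exact: segment_ball xyz.
case: xyz => t /=; rewrite in_itv/= => /andP[t0 t1] <-.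
move: x0 y0; rewrite /= !mxE; set a := x ord0 i0; set b := y ord0 i0 => a0 b0.
have [t0'|t0'] := eqVneq t 0; first by rewrite t0'; lra.
have {t0'}t0 : 0 < t by rewrite lt_neqAle eq_sym t0'.
nra.
Qed.

End BoundaryFlexible.

(** * The one-dimensional case *)

Section OneDimensional.
Context {R : realType} {M : topologicalType}.
Implicit Types (J : set R) (f psi gam : R -> M).

Definition continuous_on J f := forall s, J s -> forall N, nbhs (f s) N ->
  \forall t \near s, J t -> N (f t).

Lemma continuous_on_compact J f K : continuous_on J f -> compact K -> K `<=` J ->
  compact (f @` K).
Proof.
move=> cf cK KJ; apply: continuous_compact => //.
apply/subspace_continuousP => s Ks N sN.
by have := cf s (KJ _ Ks) N sN; apply: filterS => t tN Kt; exact/tN/KJ.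
Qed.

Definition arc_chart J psi := [/\ is_interval J,
  forall s t, J s -> J t -> psi s = psi t -> s = t, continuous_on J psi &
  forall s V, J s -> nbhs s V -> nbhs (psi s) (psi @` (V `&` J))].

(* An arc of length l; openness of the images of `[0, s[ makes it start at a
   boundary point and encodes invariance of domain. *)
Definition initial_arc gam (l : R) := [/\ 0 < l,
  forall s t, 0 <= s <= l -> 0 <= t <= l -> gam s = gam t -> s = t,
  continuous_on `[0, l]%classic gam &
  forall s, 0 < s <= l -> open (gam @` `[0, s[%classic)].

Lemma interval_locally_constant J (D : set R) : is_interval J ->
  (forall s, J s -> \forall t \near s, J t -> (D t <-> D s)) ->
  forall s t, J s -> J t -> D s -> D t.
Proof.
move=> /connected_intervalP cJ loc s t Js Jt Ds.
suff E : J `&` D = J by have [] : (J `&` D) t by rewrite E.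
apply: cJ; first by exists s.
- exists (~` closure (J `\` D)); first by rewrite openC; exact: closed_closure.
  apply/seteqP; split=> x [Jx Dx]; split=> //.
    move=> /(_ _ (loc x Jx))[y [[Jy nDy]]] /= /(_ Jy)[_ /(_ Dx)].
    exact: nDy.
  by apply: contrapT => nDx; apply: Dx; exact: subset_closure.
- exists (closure (J `&` D)); first exact: closed_closure.
  apply/seteqP; split=> x [Jx Dx]; split=> //; first exact: subset_closure.
  by move: Dx => /(_ _ (loc x Jx))[y [[Jy Dy]]] /= /(_ Jy)[+ _]; exact.
Qed.

(** Reflection reduces prolongation to the left in a chart to prolongation to the right. *)
Lemma arc_chart_opp J psi :
  arc_chart J psi -> arc_chart (-%R @^-1` J) (psi \o -%R).
Proof.
have oppn (s : R) (P : set R) : nbhs (- s) P -> nbhs s (-%R @^-1` P).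
  move=> /nbhs_norm_ltP[r r0 rP]; apply/nbhs_norm_ltP; exists r => // t st.
  by apply: rP; rewrite -opprD normrN.
move=> [iJ inj cJ oJ]; split.
- move=> s t Js Jt u /andP[su ut].
  by apply: (iJ (- t) (- s)) => //; rewrite !lerN2 ut.
- by move=> s t Js Jt /(inj _ _ Js Jt)/oppr_inj.
- by move=> s Js N /(cJ _ Js)/oppn.
- move=> s V Js sV.
  have /(oJ _ _ Js) : nbhs (- s) (-%R @^-1` V) by apply: oppn; rewrite opprK.
  apply: filterS => _ [t [Vt Jt] <-].
  by exists (- t); rewrite /= ?opprK.
Qed.

Lemma initial_arc_compact gam l : initial_arc gam l ->
  compact (gam @` `[0, l]%classic).
Proof.
by move=> [_ _ cg _]; apply: continuous_on_compact cg _ _ => //;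
  exact: segment_compact.
Qed.

Hypothesis M_hausdorff : hausdorff_space M.
Hypothesis M_connected : connected [set: M].

(** The arc is closed by compactness, and open as the union of the image of [[0, l[] and [N]. *)
Lemma initial_arc_full gam l (N : set M) : initial_arc gam l ->
  open N -> N (gam l) -> N `<=` gam @` `[0, l]%classic ->
  gam @` `[0, l]%classic = setT.
Proof.
move=> arc oN Nl Nsub; have [l0 _ _ og] := arc.
have cl : closed (gam @` `[0, l]%classic).
  by apply: compact_closed => //; exact: initial_arc_compact.
apply: M_connected; last by exists (gam @` `[0, l]%classic); rewrite ?setTI.
  by exists (gam l), l => //=; rewrite in_itv/= lexx ltW.
exists (gam @` `[0, l[%classic `|` N).
  by apply: openU => //; apply: og; rewrite l0 lexx.
rewrite setTI; apply/seteqP; split=> [_ [s /= + <-]|x [[s /= + <-]|/Nsub//]].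
  rewrite in_itv/= => /andP[s0]; rewrite le_eqVlt => /orP[/eqP ->|sl]; first by right.
  by left; exists s => //=; rewrite in_itv/= s0.
by rewrite in_itv/= => /andP[s0 sl]; exists s => //=; rewrite in_itv/= s0 ltW.
Qed.

Definition arc_extension gam l J psi (b : R) := exists gam' l',
  [/\ initial_arc gam' l', gam @` `[0, l]%classic `<=` gam' @` `[0, l']%classic &
      psi @` (J `&` [set t | t <= b]) `<=` gam' @` `[0, l']%classic].

(** The chart can leave the arc only at [c]: its left part runs inside the image [V] of [[0, l[] and
    its right part outside. So [gam] followed by [psi] from [c] onwards is injective, and reaches
    past both [b] and [e]. *)
Lemma initial_arc_extend_right gam l J psi c b e :
  initial_arc gam l -> arc_chart J psi -> J c -> gam l = psi c -> J b ->
  J e -> c < e -> ~ (gam @` `[0, l]%classic) (psi e) ->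
  arc_extension gam l J psi b.
Proof.
move=> arc [iJ inj cJ oJ] Jc lc Jb Je ce nVe; have [l0 ginj cg og] := arc.
pose V := gam @` `[0, l[%classic; pose D := [set t | V (psi t)].
have Vl x : (gam @` `[0, l]%classic) x -> V x \/ x = psi c.
  move=> [s /= + <-]; rewrite in_itv/= => /andP[s0].
  rewrite le_eqVlt => /orP[/eqP ->|sl]; first by right.
  by left; exists s; rewrite //= in_itv/= s0.
have lV x : V x -> (gam @` `[0, l]%classic) x.
  move=> [s /=]; rewrite in_itv/= => /andP[s0 sl] <-.
  by exists s; rewrite //= in_itv/= s0 ltW.
have oV : open V by apply: og; rewrite l0 lexx.
have cl : closed (gam @` `[0, l]%classic).
  by apply: compact_closed => //; exact: initial_arc_compact.
(* [V] is open, and adding only the point [psi c] makes it closed. *)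
have loc s : J s -> s != c -> \forall t \near s, J t -> (D t <-> D s).
  move=> Js sc; have [Ds|nDs] := pselect (D s).
    by apply: filterS (cJ _ Js _ (open_nbhs_of oV Ds)) => t tD /tD.
  have ns : nbhs (psi s) (~` (gam @` `[0, l]%classic)).
    apply: open_nbhs_of; first by rewrite openC.
    by move=> /Vl[//|/(inj _ _ Js Jc)]; exact/eqP.
  apply: filterS (cJ _ Js _ ns) => t tD Jt; split=> // Dt.
  by case: (tD Jt); exact: lV.
have side (I : set R) : is_interval I -> I `<=` J -> ~ I c ->
    forall s t, I s -> I t -> D s -> D t.
  move=> iI IJ nIc; apply: interval_locally_constant => // s Is.
  have sc : s != c by apply/eqP => sc; apply: nIc; rewrite -sc.
  by apply: filterS (loc s (IJ _ Is) sc) => t tD /IJ/tD.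
have interval_sub (I : set R) : is_interval I -> is_interval (J `&` I).
  move=> iI s t [Js Is] [Jt It] u sut; split; first exact: iJ sut.
  exact: iI sut.
have Dright t : J t -> c < t -> ~ D t.
  move=> Jt ct Dt; apply/nVe/lV.
  apply: (side (J `&` [set t | c < t]) _ _ _ t e) => //.
  - apply: interval_sub => s u /= cs _ z /andP[sz _]; exact: lt_le_trans sz.
  - by move=> [_ /=]; rewrite ltxx.
(* A point of the arc just before its end lies in the chart, at a parameter [u] which is not [c] by
   injectivity and not beyond [c] by [Dright]; hence [D] holds somewhere, so everywhere, on the
   left. *)
have Dleft t : J t -> t < c -> D t.
  move=> Jt tc.
  have ncJ : nbhs (gam l) (psi @` (setT `&` J)).
    by rewrite lc; apply: oJ => //; exact: filterT.
  have lin : `[0, l]%classic l by rewrite /= in_itv/= lexx ltW.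
  have /nbhs_norm_ltP[r r0 rJ] := cg l lin _ ncJ.
  pose s := Num.max (l / 2) (l - r / 2).
  have s1 : l / 2 <= s by rewrite le_max lexx.
  have s2 : l - r / 2 <= s by rewrite le_max lexx orbT.
  have s3 : s < l by rewrite gt_max; apply/andP; split; lra.
  have [||u [_ Ju] us] := rJ s.
  - by rewrite gtr0_norm; lra.
  - by rewrite /= in_itv/=; apply/andP; split; lra.
  have Vs : V (gam s) by exists s; rewrite //= in_itv/=; apply/andP; split; lra.
  have Du : D u by rewrite /D/= us.
  have uc : u < c.
    rewrite ltNge le_eqVlt; apply/negP => /orP[/eqP cu|cu].
      have : s = l; last lra.
      by apply: ginj; [apply/andP; split; lra..|rewrite -us -cu -lc].
    exact: Dright Ju cu Du.
  apply: (side (J `&` [set t | t < c]) _ _ _ u t) => //.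
  - apply: interval_sub => s' u' /= _ uc' z /andP[_ zu]; exact: le_lt_trans uc'.
  - by move=> [_ /=]; rewrite ltxx.
pose m := Num.max b e.
have Jm : J m by rewrite /m; case: leP.
have em : e <= m by rewrite le_max lexx orbT.
have bm : b <= m by rewrite le_max lexx.
pose gam' t := if t <= l then gam t else psi (c + (t - l)).
pose l' := l + (m - c).
have Jcm t : c <= t <= m -> J t by exact: iJ.
have gl t : t <= l -> gam' t = gam t by rewrite /gam' => ->.
have gr t : l <= t -> gam' t = psi (c + (t - l)).
  by rewrite /gam' le_eqVlt => /orP[/eqP <-|]; [rewrite lexx lc subrr addr0|
    rewrite ltNge => /negbTE ->].
have gV t : 0 <= t < l -> V (gam' t).
  by move=> /andP[t0 tl]; rewrite gl ?ltW//; exists t; rewrite //= in_itv/= t0.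
have nV t : l <= t <= l' -> ~ V (gam' t).
  move=> /andP[lt tl']; rewrite gr//; move: lt.
  rewrite le_eqVlt => /orP[/eqP <-|lt].
    rewrite subrr addr0 -lc => -[s /=]; rewrite in_itv/= => /andP[s0 sl] sE.
    have : s = l by apply: ginj => //; apply/andP; split; lra.
    lra.
  by apply: Dright; [apply: Jcm; apply/andP; split; rewrite /l' in tl'; lra|lra].
exists gam', l'; split; first split.
- by rewrite /l'; lra.
- move=> s t /andP[s0 sl] /andP[t0 tl].
  have [sl1|ls] := ltP s l; have [tl1|lt] := ltP t l => E.
  + by apply: ginj; [rewrite s0 ltW|rewrite t0 ltW|move: E; rewrite !gl ?ltW].
  + case: (nV t); first by rewrite lt.
    by rewrite -E; apply: gV; rewrite s0.
  + case: (nV s); first by rewrite ls.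
    by rewrite E; apply: gV; rewrite t0.
  + move: E; rewrite !gr// => /inj E.
    have : c + (s - l) = c + (t - l); last lra.
    by apply: E; apply: Jcm; apply/andP; split; rewrite /l' in sl tl; lra.
- move=> s /=; rewrite in_itv/= => /andP[s0 sl'] N sN.
  have near_left : s <= l -> \forall t \near s, 0 <= t <= l -> N (gam' t).
    move=> sl; have sin : `[0, l]%classic s by rewrite /= in_itv/= s0.
    move: sN; rewrite gl// => /(cg _ sin); apply: filterS => t tN /andP[t0 tl].
    by rewrite gl//; apply: tN; rewrite /= in_itv/= t0.
  have near_right : l <= s -> \forall t \near s, l <= t <= l' -> N (gam' t).
    move=> ls; have sin : J (c + (s - l)).
      by apply: Jcm; apply/andP; split; rewrite /l' in sl'; lra.
    move: sN; rewrite gr// => /(cJ _ sin)/nbhs_norm_ltP[r r0 rN].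
    apply/nbhs_norm_ltP; exists r => // t st /andP[lt tl'].
    rewrite gr//; apply: rN.
      by rewrite (_ : _ - _ = s - t)//; lra.
    by apply: Jcm; apply/andP; split; rewrite /l' in tl'; lra.
  have [sl|ls|sl] := ltgtP s l.
  + apply: filterS2 (near_left (ltW sl)) (open_nbhs_of (@open_lt R l) sl) => t tN tl.
    rewrite in_itv/= => /andP[t0 _]; apply: tN; rewrite t0; exact: ltW.
  + apply: filterS2 (near_right (ltW ls)) (open_nbhs_of (@open_gt R l) ls) => t tN lt.
    rewrite in_itv/= => /andP[_ tl']; apply: tN; rewrite tl' andbT; exact: ltW.
  + have sl1 : s <= l by rewrite sl.
    have ls1 : l <= s by rewrite sl.
    apply: filterS2 (near_left sl1) (near_right ls1) => t tN1 tN2.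
    rewrite in_itv/= => /andP[t0 tl'].
    by have [tl|lt] := leP t l; [apply: tN1; rewrite t0|apply: tN2; rewrite tl' ltW].
- move=> s /andP[s0 sl'].
  have [sl|ls] := leP s l.
    have -> : gam' @` `[0, s[%classic = gam @` `[0, s[%classic.
      apply: eq_imagel => t /=; rewrite in_itv/= => /andP[_ ts].
      by rewrite gl//; lra.
    by apply: og; rewrite s0.
  (* The left part of [J] may be added freely, being already in [V]; this exhibits the image as a
     union of open sets. *)
  have -> : gam' @` `[0, s[%classic =
      V `|` psi @` ([set t | t < c + (s - l)] `&` J).
    apply/seteqP; split=> [x [t /=]|x].
      rewrite in_itv/= => /andP[t0 ts] <-.
      have [tl|lt] := ltP t l; first by left; apply: gV; rewrite t0.
      right; exists (c + (t - l)); last by rewrite gr.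
      split=> /=; first by lra.
      by apply: Jcm; apply/andP; split; rewrite /l' in sl'; lra.
    move=> [[t /=]|[t [/= tc Jt] <-]].
      rewrite in_itv/= => /andP[t0 tl] <-.
      by exists t; rewrite ?gl ?ltW//= in_itv/= t0/=; exact: lt_trans ls.
    have [/(Dleft _ Jt)[u /=]|ct] := ltP t c.
      rewrite in_itv/= => /andP[u0 ul] <-.
      by exists u; rewrite ?gl ?ltW//= in_itv/= u0/=; exact: lt_trans ls.
    exists (l + (t - c)); first by rewrite /= in_itv/=; apply/andP; split; lra.
    by rewrite gr; [congr psi; lra|lra].
  apply: openU => //; rewrite openE => _ [t [/= ts Jt] <-].
  apply: (oJ t [set u | u < c + (s - l)]) => //.
  exact: (open_nbhs_of (@open_lt R _)).
- move=> x [t /=]; rewrite in_itv/= => /andP[t0 tl] <-.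
  by exists t; rewrite ?gl//= in_itv/= t0 /l'/=; lra.
- move=> _ [t [Jt /= tb] <-]; have [/(Dleft _ Jt)[u /=]|ct] := ltP t c.
    rewrite in_itv/= => /andP[u0 ul] <-.
    by exists u; rewrite ?gl ?ltW//= in_itv/= u0 /l'/=; lra.
  exists (l + (t - c)); first by rewrite /= in_itv/= /l'; apply/andP; split; lra.
  by rewrite gr; [congr psi; lra|lra].
Qed.

End OneDimensional.

(* compact_cover is only available for pointed spaces. *)
Lemma compact_nbhs_cover (X : topologicalType) (K : set X) (N : X -> set X) :
  compact K -> (forall x, K x -> nbhs x (N x)) ->
  exists s : seq X, forall x, K x -> exists2 y, y \in s & N y x.
Proof.
move=> /compact_near_coveringP near_K KN.
pose F := filter_from [set: seq X] (fun s => [set t : seq X | {subset s <= t}]).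
have FF : Filter F.
  apply: filter_from_filter; first by exists [::].
  move=> s t _ _; exists (s ++ t) => // u stu.
  by split=> x xs; apply: stu; rewrite mem_cat xs ?orbT.
have [|s _ sP] := near_K _ F (fun s x => exists2 y, y \in s & N y x) FF.
  move=> x Kx; exists (N x, [set t : seq X | {subset [:: x] <= t}]).
    by split=> /=; [exact: KN|exists [:: x]].
  by move=> [x' t] /= [Nx' xt]; exists x => //; apply: xt; rewrite inE.
by exists s; apply: sP.
Qed.

(** * Filling a compact one-dimensional manifold by an arc *)

Section Interval.
Context {R : realType} {M : topologicalType}.
Implicit Types (J : set R) (psi gam : R -> M).
Hypothesis M_hausdorff : hausdorff_space M.
Hypothesis M_connected : connected [set: M].
Hypothesis M_compact : compact [set: M].

(** If the whole chart lies in the arc, the end of the arc is interior to it and the arc fills [M];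
    otherwise a chart point off the arc tells on which side of [c] to prolong. *)
Lemma initial_arc_extend gam l J psi c a b :
  initial_arc gam l -> arc_chart J psi -> J c -> gam l = psi c -> J a -> J b ->
  gam @` `[0, l]%classic = setT \/
  exists gam' l',
    [/\ initial_arc gam' l', gam @` `[0, l]%classic `<=` gam' @` `[0, l']%classic &
        psi @` (J `&` `[a, b]%classic) `<=` gam' @` `[0, l']%classic].
Proof.
move=> arc chJ Jc lc Ja Jb; have [iJ inj cJ oJ] := chJ.
have [sub|] := pselect (psi @` J `<=` gam @` `[0, l]%classic).
  left; apply: (@initial_arc_full _ _ M_hausdorff M_connected _ _ (psi @` J)°).
  - exact: arc.
  - exact: open_interior.
  - have cN := oJ c setT Jc filterT; rewrite setTI in cN.
    by rewrite lc; exact: cN.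
  - by apply: subset_trans sub; exact: interior_subset.
move=> /existsNP[_ /not_implyP[[y Jy <-] nVy]]; right.
have lV : (gam @` `[0, l]%classic) (psi c).
  by have [l0 _ _ _] := arc; exists l; rewrite //= in_itv/= lexx ltW.
have [yc|cy|yc] := ltgtP y c; last by rewrite yc in nVy.
- have [|||||| gam' [l' [arc' sub cov]]] := initial_arc_extend_right M_hausdorff
    (c := - c) (b := - a) (e := - y) arc (arc_chart_opp chJ).
  + by rewrite /= opprK.
  + by rewrite /= opprK.
  + by rewrite /= opprK.
  + by rewrite /= opprK.
  + by rewrite ltrN2.
  + by rewrite /= opprK.
  exists gam', l'; split=> // x [t [Jt /=]].
  rewrite in_itv/= => /andP[at_ _] <-; apply: cov.
  by exists (- t); rewrite /= ?opprK// lerN2.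
- have [gam' [l' [arc' sub cov]]] :=
    initial_arc_extend_right M_hausdorff arc chJ Jc lc Jb Jy cy nVy.
  exists gam', l'; split=> // x [t [Jt /=]].
  by rewrite in_itv/= => /andP[_ tb] <-; apply: cov; exists t.
Qed.

(** The coordinate [c] of [x] is kept, not translated to 0: a positive [c] makes [x] an interior
    point, which forces [c = 0] at a boundary point. *)
Lemma half_line_arc_chart (x : M) : locally_homeomorphic_at (half_space R 1) x ->
  exists psi c r, let J := [set t | 0 <= t /\ `|c - t| < r] in
    [/\ 0 < r, 0 <= c, psi c = x, arc_chart J psi &
        0 < c -> manifold_interior R 1 M x].
Proof.
move=> /locally_homeomorphic_chart[W [U [psi [kap [Ux ch]]]]].
have [oU oW UP WP [ck cp]] := ch; have [Wx Hx xE] := UP _ Ux.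
have HP (v : 'rV[R]_1) : half_space R 1 v <-> 0 <= v ord0 ord0.
  split=> [|v0 i _]; first by apply.
  by rewrite (ord1 i).
have constE (v : 'rV[R]_1) : const_mx (v ord0 ord0) = v.
  by apply/rowP => i; rewrite mxE (ord1 i).
have normE (v w : 'rV[R]_1) : `|v - w| = `|v ord0 ord0 - w ord0 ord0|.
  apply/eqP; rewrite eq_le; apply/andP; split.
    by apply: row_norm_le => // i; rewrite (ord1 i) !mxE.
  by have := row_entry_le (v - w) ord0; rewrite !mxE.
set c := kap x ord0 ord0.
have cE : const_mx c = kap x by exact: constE.
have /nbhs_norm_ltP[r r0 rW] : nbhs (kap x) W by exact: open_nbhs_of.
have WJ t : `|c - t| < r -> W (const_mx t).
  by move=> ct; apply: rW; rewrite normE !mxE.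
exists (psi \o const_mx), c, r; split=> //.
- exact/HP.
- by rewrite /= cE.
- split.
  + move=> s t [s0 cs] [t0 ct] u /andP[su ut]; split; first by lra.
    by move: cs ct; rewrite !ltr_norml => /andP[? ?] /andP[? ?]; apply/andP; split; lra.
  + move=> s t [s0 cs] [t0 ct] /(congr1 kap) /=.
    rewrite (WP _ (WJ _ cs) _).2; last by apply/HP; rewrite mxE.
    rewrite (WP _ (WJ _ ct) _).2; last by apply/HP; rewrite mxE.
    by move=> /rowP/(_ ord0); rewrite !mxE.
  + move=> s [s0 cs] N sN.
    have Hs : half_space R 1 (const_mx s) by apply/HP; rewrite mxE.
    have /nbhs_norm_ltP[e e0 eN] := cp _ (WJ _ cs) Hs _ sN.
    apply/nbhs_norm_ltP; exists e => // t st [t0 _] /=; apply: eN.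
      by rewrite normE !mxE.
    by apply/HP; rewrite mxE.
  + move=> s V [s0 cs] /nbhs_norm_ltP[e e0 eV].
    have Hs : half_space R 1 (const_mx s) by apply/HP; rewrite mxE.
    have [Us sE] := WP _ (WJ _ cs) Hs.
    pose e' := Num.min e (r - `|c - s|).
    have e'0 : 0 < e' by rewrite lt_min e0 subr_gt0.
    have near_s : nbhs (kap (psi (const_mx s)))
        [set w : 'rV[R]_1 | `|const_mx s - w| < e'].
      by rewrite sE; apply/nbhs_norm_ltP; exists e'.
    apply: filterS2 (ck _ Us _ near_s) (open_nbhs_of oU Us) => z /=.
    rewrite normE mxE lt_min => /andP[sz1 sz2] Uz.
    have [_ /HP Hz zE] := UP _ Uz.
    exists (kap z ord0 ord0); last by rewrite /= constE.
    split; first exact: eV.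
    split=> //; have := ler_distD s c (kap z ord0 ord0); lra.
- move=> c0; pose W' := W `&` [set v : 'rV[R]_1 | 0 < v ord0 ord0].
  have oW' : open W' by apply: openI => //; exact: open_first_coordinate_gt0.
  have W'H : W' `&` half_space R 1 = W' `&` setT.
    by apply/seteqP; split=> v [[Wv v0] _] //; split=> //; apply/HP; exact: ltW.
  have chI := chart_restrict ch oW' (fun v W'v => W'v.1) W'H.
  by apply: (chart_interior chI); split.
Qed.

Lemma boundary_initial_arc (p : M) : locally_homeomorphic_at (half_space R 1) p ->
  manifold_boundary R 1 M p -> exists (gam : R -> M) l, initial_arc gam l.
Proof.
move=> /half_line_arc_chart[psi [c [r [r0 c0 pE [iJ inj cJ oJ] cI]]]] Bp.
have {}c0 : c = 0.
  by apply/eqP; rewrite eq_le c0 andbT leNgt; apply/negP => /cI.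
have JP t : 0 <= t < r -> 0 <= t /\ `|c - t| < r.
  by move=> /andP[t0 tr]; split=> //; rewrite c0 sub0r normrN ger0_norm.
exists psi, (r / 2); split.
- lra.
- by move=> s t /andP[? ?] /andP[? ?]; apply: inj; apply: JP; apply/andP; split; lra.
- move=> s /=; rewrite in_itv/= => /andP[? ?] N sN.
  have Js : 0 <= s /\ `|c - s| < r by apply: JP; apply/andP; split; lra.
  apply: filterS (cJ s Js N sN) => t tN; rewrite in_itv/= => /andP[? ?].
  by apply/tN/JP; apply/andP; split; lra.
- move=> s /andP[s0 sr]; rewrite openE => _ [t /= + <-].
  rewrite in_itv/= => /andP[t0 ts].
  have Jt : 0 <= t /\ `|c - t| < r by apply: JP; apply/andP; split; lra.
  apply: filterS (oJ t _ Jt (open_nbhs_of (@open_lt R s) ts)) => _ [u [/= us [u0 _]] <-].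
  by exists u; rewrite //= in_itv/= u0.
Qed.

Lemma full_arc_homeomorphic gam l : initial_arc gam l ->
  gam @` `[0, l]%classic = setT -> homeomorphic M (set_type `[0, l]%classic).
Proof.
move=> [l0 inj cg _] full.
have /choice[f fP] : forall x, exists s, `[0, l]%classic s /\ gam s = x.
  move=> x; have [s sI sx] : (gam @` `[0, l]%classic) x by rewrite full.
  by exists s.
have fin x : `[0, l]%classic (f x) := (fP x).1.
have fE x : gam (f x) = x := (fP x).2.
have itvP s : `[0, l]%classic s -> 0 <= s <= l by rewrite /= in_itv.
have memI (s : set_type `[0, l]%classic) : `[0, l]%classic (set_val s).
  exact: set_mem (svalP s).
pose F x : set_type `[0, l]%classic := to_set_type (fin x).
have FE x : set_val (F x) = f x by exact: set_val_to_set_type.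
exists F; split.
  move=> x P /nbhs_set_type[V]; rewrite FE => xV VP.
  (* The usual compactness argument for the continuity of the inverse: closed subsets of [[0, l]]
     have compact, hence closed, images. *)
  pose K := `[0, l]%classic `\` V°.
  have cK : compact (gam @` K).
    apply: (continuous_on_compact cg); last by move=> s [].
    apply: (subclosed_compact _ (@segment_compact R 0 l)); last by move=> s [].
    apply: closedI; first exact: itv_closed.
    by rewrite closedC; exact: open_interior.
  have oK : open (~` (gam @` K)) by rewrite openC; exact: compact_closed.
  have Kx : (~` (gam @` K)) x.
    move=> [s [sI sV] sx]; apply: sV.
    have -> : s = f x by apply: inj; [exact: itvP|exact: itvP|rewrite fE].
    exact: nbhs_singleton (nbhs_interior xV).
  apply: filterS (open_nbhs_of oK Kx) => y Ky; apply: VP; rewrite FE.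
  apply: interior_subset; apply: contrapT => nV; apply: Ky.
  by exists (f y).
exists (fun s => gam (set_val s)); split.
- move=> s N /(cg _ (memI s)) sN.
  have sN2 := @initial_continuous _ _ set_val s _ sN : nbhs s _.
  by apply: filterS sN2 => t; apply; exact: memI.
- by move=> x; rewrite FE fE.
- move=> s; apply: val_inj; rewrite -!set_valE FE.
  by apply: inj; [exact: itvP|exact/itvP/memI|rewrite fE].
Qed.

(** Induction on the number of sets of a finite cover not contained in the arc. The cover set around
    the end of the arc is either already contained, and then the arc is everything, or is swallowed
    by the next prolongation. *)
Lemma compact_one_manifold (p : M) :
  (forall x : M, locally_homeomorphic_at (half_space R 1) x) ->
  manifold_boundary R 1 M p ->
  exists a b : R, a < b /\ homeomorphic M (set_type `[a, b]%classic).
Proof.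
move=> Mloc Bp.
have /choice[D DP] : forall x : M, exists D : (R -> M) * set R * (R * R * R),
    let: (psi, J, (c, a, b)) := D in
    [/\ arc_chart J psi, nbhs x (psi @` (J `&` `[a, b]%classic)),
        J a, J b & forall y, (psi @` (J `&` `[a, b]%classic)) y ->
          exists2 c, J c & y = psi c].
  move=> x; have [psi [c [r [r0 c0 xE chJ _]]]] := half_line_arc_chart (Mloc x).
  exists (psi, [set t | 0 <= t /\ `|c - t| < r],
    (c, Num.max 0 (c - r / 2), c + r / 2)).
  have c1 : 0 <= Num.max 0 (c - r / 2) by rewrite le_max lexx.
  have c2 : c - r / 2 <= Num.max 0 (c - r / 2) by rewrite le_max lexx orbT.
  have c3 : Num.max 0 (c - r / 2) <= c by rewrite ge_max c0/=; lra.
  split=> //.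
  - have Jc : 0 <= c /\ `|c - c| < r by rewrite subrr normr0.
    have near_c : nbhs c [set t | `|c - t| < r / 2].
      by apply/nbhs_norm_ltP; exists (r / 2) => //; lra.
    have [_ _ _ oJ] := chJ; rewrite -xE.
    apply: filterS (oJ _ _ Jc near_c) => _ [t [/= ct [t0 ctr]] <-].
    exists t => //; split=> //=; rewrite in_itv/= ge_max t0/=.
    by move: ct; rewrite ltr_norml => /andP[? ?]; apply/andP; split; lra.
  - by split=> //; rewrite ger0_norm; lra.
  - by split; [lra|rewrite ltr_norml; apply/andP; split; lra].
  - by move=> _ [t [Jt _] <-]; exists t.
pose N x := let: (psi, J, (c, a, b)) := D x in psi @` (J `&` `[a, b]%classic).
have xN x : nbhs x (N x) by rewrite /N; case: (D x) (DP x) => [[? ?] [[? ?] ?]] [].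
have [T cover] := compact_nbhs_cover M_compact (fun x _ => nbhs_interior (xN x)).
have [gam0 [l0 arc0]] := boundary_initial_arc (Mloc p) Bp.
pose bad (gam : R -> M) (l : R) x := ~~ `[< N x `<=` gam @` `[0, l]%classic >].
suff ext (k : nat) gam l : initial_arc gam l -> (count (bad gam l) T <= k)%N ->
    exists gam' l', initial_arc gam' l' /\ gam' @` `[0, l']%classic = setT.
  have [gam [l [arc full]]] := ext _ _ _ arc0 (leqnn _).
  by exists 0, l; split; [case: arc|exact: full_arc_homeomorphic arc full].
elim: k gam l => [|k IH] gam l arc cnt;
  have [x /= xT Nl] := cover (gam l) I;
  have [sub|nsub] := pselect (N x `<=` gam @` `[0, l]%classic).
- exists gam, l; split=> //.
  apply: (initial_arc_full M_hausdorff M_connected arc (open_interior (N x)) Nl).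
  by apply: subset_trans sub; exact: interior_subset.
- move: cnt; rewrite leqn0 => /eqP cnt; exfalso.
  have : has (bad gam l) T.
    by apply/hasP; exists x => //; exact/asboolP.
  by rewrite has_count cnt.
- exists gam, l; split=> //.
  apply: (initial_arc_full M_hausdorff M_connected arc (open_interior (N x)) Nl).
  by apply: subset_trans sub; exact: interior_subset.
have [full|[gam' [l' [arc' sub cov]]]] :
    gam @` `[0, l]%classic = setT \/ exists gam' l', [/\ initial_arc gam' l',
      gam @` `[0, l]%classic `<=` gam' @` `[0, l']%classic &
      N x `<=` gam' @` `[0, l']%classic].
  move: Nl => /interior_subset; rewrite /N.
  case: (D x) (DP x) => [[psi J] [[c a] b]] [chJ _ Ja Jb NJ] /NJ[c' Jc' lc'].
  exact: initial_arc_extend arc chJ Jc' lc' Ja Jb.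
  by exists gam, l.
apply: (IH gam' l' arc'); rewrite -ltnS; apply: leq_trans cnt.
set P := bad gam' l'; set Q := bad gam l.
have PQ y : P y -> Q y.
  by move=> /asboolP Py; apply/asboolP => Qy; apply: Py; exact: subset_trans sub.
have nPx : ~~ P x by rewrite negbK; exact/asboolP.
have Qx : Q x by exact/asboolP.
(* The count drops strictly: the bad sets after prolongation, together with [x], were all bad
   before, and [x] no longer is. *)
have := count_predUI P (pred1 x) T.
have -> : count (predI P (pred1 x)) T = 0%N.
  apply/eqP; rewrite -leqn0 leqNgt -has_count; apply/hasPn => y _ /=.
  by apply/negP => /andP[Py /eqP yx]; move: nPx; rewrite -yx Py.
rewrite addn0 => cE; have : (0 < count (pred1 x) T)%N.
  by rewrite -has_count; apply/hasP; exists x => /=.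
move=> x0; apply: (@leq_trans (count (predU P (pred1 x)) T)).
  by rewrite cE -addn1 leq_add2l.
by apply: sub_count => y /= /orP[/PQ//|/eqP ->].
Qed.

End Interval.

Theorem theorem1p6 (R : realType) (d : nat) (M : uniformType)
    (M_manifold : manifold_with_boundary R d M)
    (M_compact : compact [set: M])
    (M_connected : connected [set: M])
    (M_boundary : manifold_boundary R d M !=set0)
    (M_not_interval : ~ exists a b : R,
       a < b /\ homeomorphic M (set_type `[a, b]%classic))
    (n : nat) (n_gt0 : (0 < n)%N) :
  exists C : set {ptws 'I_n -> set_type (homeo0 R d M)},
    [/\ closed C, nowhere_dense C & dense_generating_tuples R d M n `<=` C].
Proof.
have [M_hausdorff _ Mloc] := M_manifold; have [p Bp] := M_boundary.
have [d1|d1] := ltnP 1 d.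
  apply: (dense_generating_tuples_nowhere_dense M_hausdorff M_compact Bp).
  exact: half_space_flexible_near.
exfalso; case: d d1 M_manifold M_boundary Mloc Bp => [|[|//]] _ _ _ Mloc Bp.
  (* The condition defining the half-space ranges over the empty type ['I_0], so every point is
     interior. *)
  have H0 : half_space R 0 = setT by apply/seteqP; split=> // v _ [].
  by apply: Bp; rewrite /manifold_interior/= -H0.
apply: M_not_interval.
exact: (compact_one_manifold M_hausdorff M_connected M_compact Mloc Bp).
Qed.
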